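(* Let $R$ be a commutative noetherian local ring and $M$ a finitely generated $R$-module of finite G-dimension. The following conditions are equivalent. (i) $M$ has rank and $\chi^{\mathcal{G}}(M)=\operatorname{rank}_R(M)$. (ii) $\operatorname{pdim}_R(M)<\infty$.
   Context: Let $(R,\mathfrak{m},k)$ be a commutative noetherian local ring and set $(-)^*=\operatorname{Hom}_R(-,R)$. A finitely generated $R$-module $G$ is totally reflexive if the biduality map $G\to G^{**}$ is bijective and $\operatorname{Ext}^i_R(G,R)=0=\operatorname{Ext}^i_R(G^*,R)$ for all $i\neq 0$. A G-resolution of a finitely generated module $M$ is a complex $G$ of totally reflexive modules with $G_n=0$ for $n<0$, $H_n(G)=0$ for $n>0$ and $H_0(G)\cong M$; its augmented G-resolution $G^+$ is the exact sequence $\cdots\to G_1\to G_0\to M\to 0$. The G-dimension is $\operatorname{G-dim}_R(M)=\inf\{\sup\{n\geq 0\mid G_n\neq 0\}\mid G \text{ is a G-resolution of } M\}$. A G-resolution $G$ is proper if $\operatorname{Hom}_R(H,G^+)$ is exact for every totally reflexive $R$-module $H$. Every finitely generated $M$ of finite G-dimension has a bounded proper G-resolution, and proper G-resolutions are unique up to homotopy equivalence, so $\operatorname{Tor}^{\mathcal{G}}_n(M,N)=H_n(G\otimes_R N)$, with $G$ a proper G-resolution of $M$, is well defined. The relative Betti numbers are $\beta_n^{\mathcal{G}}(M)=\dim_k\operatorname{Tor}_n^{\mathcal{G}}(M,k)$, which vanish for $n<0$ and $n>\operatorname{G-dim}_R(M)$. The G-Euler characteristic of $M$ is $\chi^{\mathcal{G}}(M)=\sum_{n\geq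 0}(-1)^n\beta_n^{\mathcal{G}}(M)$. A finitely generated module $M$ has rank $r$ if $U^{-1}M\cong (U^{-1}R)^r$, where $U$ is the set of nonzerodivisors of $R$. Here $\operatorname{pdim}_R$ denotes projective dimension. *)

(* Defs.v *)
From HB Require Import structures.
From mathcomp Require Import all_boot all_order all_algebra.
From mathcomp Require Import ring_quotient generic_quotient sesquilinear.
From mathcomp Require Import all_classical.
From mathcomp Require Import ring.

Set Implicit Arguments.
Unset Strict Implicit.
Unset Printing Implicit Defensive.

Import GRing.Theory.

Local Open Scope ring_scope.
Local Open Scope quotient_scope.
Local Open Scope classical_set_scope.

Definition lmod_iso (R : comNzRingType) (U V : lmodType R) : Prop :=
  exists f : {linear U -> V}, bijective f.

Definition zero_module (R : comNzRingType) (V : lmodType R) : Prop :=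
  forall x : V, x = 0.

Definition generates (R : comNzRingType) (V : lmodType R)
    (s : seq V) (S : {pred V}) : Prop :=
  forall x, (x \in S) <->
    exists c : nat -> R, x = \sum_(i < size s) c i *: s`_i.

Definition fin_gen (R : comNzRingType) (V : lmodType R) : Prop :=
  exists s : seq V, generates s predT.

Definition projective (R : comNzRingType) (P : lmodType R) : Prop :=
  forall (A B : lmodType R) (p : {linear A -> B}) (f : {linear P -> B}),
    (forall b, exists a, p a = b) ->
    exists g : {linear P -> A}, p \o g =1 f.

(* The ideals of R are the submodules of R^o. *)
Definition noetherian (R : comNzRingType) : Prop :=
  forall I : submodClosed R^o, exists s : seq R^o, generates s I.

(* [idealr R] is MathComp's type of proper ideals. *)
Definition maximal_ideal (R : comNzRingType) (m : idealr R) : Prop :=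
  forall I : idealr R, {subset m <= I} -> I =i m.

Definition local_ring (R : comNzRingType) (m : idealr R) : Prop :=
  maximal_ideal m /\ forall m' : idealr R, maximal_ideal m' -> m' =i m.

Section HomModule.
Variables (R : comNzRingType) (U V : lmodType R).

Definition Hom : Type := {linear U -> V}.

HB.instance Definition _ := gen_eqMixin Hom.
HB.instance Definition _ := gen_choiceMixin Hom.

Lemma Hom_ext (f g : Hom) : (forall x, f x = g x) -> f = g.
Proof.
case: f g => [f [[f1] [f2]]] [g [[g1] [g2]]] /= /funext fg; subst g.
by rewrite (Prop_irrelevance f1 g1) (Prop_irrelevance f2 g2).
Qed.

Definition hom_zero : Hom := [the {linear U -> V} of \0].
Definition hom_add (f g : Hom) : Hom := [the {linear U -> V} of f \+ g].

Fact hom_opp_linear (f : Hom) : linear (fun x => - f x).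
Proof. by move=> a x y; rewrite linearP opprD scalerN. Qed.
Definition hom_opp (f : Hom) : Hom :=
  HB.pack (fun x => - f x)
    (GRing.isLinear.Build R U V *:%R (fun x => - f x) (hom_opp_linear f)).

Fact hom_scale_linear (a : R) (f : Hom) : linear (fun x => a *: f x).
Proof. by move=> b x y; rewrite linearP scalerDr !scalerA mulrC. Qed.
Definition hom_scale (a : R) (f : Hom) : Hom :=
  HB.pack (fun x => a *: f x)
    (GRing.isLinear.Build R U V *:%R (fun x => a *: f x) (hom_scale_linear a f)).

Fact hom_addA : associative hom_add.
Proof. by move=> f g h; apply: Hom_ext => x /=; rewrite addrA. Qed.
Fact hom_addC : commutative hom_add.
Proof. by move=> f g; apply: Hom_ext => x /=; rewrite addrC. Qed.
Fact hom_add0 : left_id hom_zero hom_add.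
Proof. by move=> f; apply: Hom_ext => x /=; rewrite add0r. Qed.
Fact hom_addN : left_inverse hom_zero hom_opp hom_add.
Proof. by move=> f; apply: Hom_ext => x /=; rewrite addNr. Qed.
HB.instance Definition _ :=
  GRing.isZmodule.Build Hom hom_addA hom_addC hom_add0 hom_addN.

Fact hom_scaleA a b f : hom_scale a (hom_scale b f) = hom_scale (a * b) f.
Proof. by apply: Hom_ext => x /=; rewrite scalerA. Qed.
Fact hom_scale1 : left_id 1 hom_scale.
Proof. by move=> f; apply: Hom_ext => x /=; rewrite scale1r. Qed.
Fact hom_scaleDr : right_distributive hom_scale +%R.
Proof. by move=> a f g; apply: Hom_ext => x /=; rewrite scalerDr. Qed.
Fact hom_scaleDl f : {morph hom_scale^~ f : a b / a + b}.
Proof. by move=> a b; apply: Hom_ext => x /=; rewrite scalerDl. Qed.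
HB.instance Definition _ := GRing.Zmodule_isLmodule.Build R Hom
  hom_scaleA hom_scale1 hom_scaleDr hom_scaleDl.

End HomModule.

Section Postcomposition.
Variables (R : comNzRingType) (H U V : lmodType R) (f : {linear U -> V}).

Definition hom_post (g : Hom H U) : Hom H V :=
  [the {linear H -> V} of f \o g].

Fact hom_post_linear : linear hom_post.
Proof. by move=> a g h; apply: Hom_ext => x /=; rewrite linearP. Qed.
HB.instance Definition _ :=
  GRing.isLinear.Build R (Hom H U) (Hom H V) *:%R hom_post hom_post_linear.

End Postcomposition.

Definition dual (R : comNzRingType) (V : lmodType R) : lmodType R :=
  Hom V R^o.

Section Biduality.
Variables (R : comNzRingType) (V : lmodType R).

Fact eval_at_linear (x : V) : linear ((fun f : Hom V R^o => f x) : Hom V R^o -> R^o).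
Proof. by []. Qed.
Definition biduality (x : V) : dual (dual V) :=
  HB.pack ((fun f : Hom V R^o => f x) : Hom V R^o -> R^o)
    (GRing.isLinear.Build R (Hom V R^o) R^o *:%R _ (eval_at_linear x)).

End Biduality.

Section SubModule.
Variables (R : comNzRingType) (V : lmodType R) (S : submodClosed V).

Record submod : Type := SubMod { submod_val : V; _ : submod_val \in S }.

HB.instance Definition _ := [isSub for submod_val].
HB.instance Definition _ := [Choice of submod by <:].
HB.instance Definition _ := [SubChoice_isSubLmodule of submod by <:].

End SubModule.

Section QuotientModule.
Variables (R : comNzRingType) (V : lmodType R) (S : submodClosed V).

Definition sub_pred : {pred V} := [pred x | x \in S].

Fact sub_pred_zmod_closed : zmod_closed sub_pred.
Proof.
split=> [|x y xS yS]; first exact: (rpred0 S).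
by rewrite -scaleN1r; apply: (@rpredD _ S) => //; apply: (@rpredZ _ _ S).
Qed.
HB.instance Definition _ :=
  GRing.isZmodClosed.Build V sub_pred sub_pred_zmod_closed.

Definition quotmod : Type := Quotient.quot sub_pred.

HB.instance Definition _ := GRing.Zmodule.on quotmod.

Definition quotmod_class (x : V) : quotmod := \pi_(Quotient.quot sub_pred) x.
Definition quotmod_scale (a : R) (q : quotmod) : quotmod :=
  quotmod_class (a *: repr q).

Lemma quotmod_classP x y : quotmod_class x = quotmod_class y <-> x - y \in S.
Proof.
rewrite -[_ \in S]/(x - y \in sub_pred) Quotient.idealrBE.
exact: (rwP eqP).
Qed.

Lemma quotmod_classD x y :
  quotmod_class (x + y) = quotmod_class x + quotmod_class y.
Proof. exact: Quotient.pi_add. Qed.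

Lemma quotmod_scaleE a x :
  quotmod_scale a (quotmod_class x) = quotmod_class (a *: x).
Proof.
apply/quotmod_classP; rewrite -scalerBr; apply: rpredZ.
by apply/quotmod_classP; rewrite /quotmod_class reprK.
Qed.

Lemma quotmodW (P : quotmod -> Prop) :
  (forall x, P (quotmod_class x)) -> forall q, P q.
Proof. by move=> h q; rewrite -[q]reprK; apply: h. Qed.

Fact quotmod_scaleA a b q :
  quotmod_scale a (quotmod_scale b q) = quotmod_scale (a * b) q.
Proof. by elim/quotmodW: q => x; rewrite !quotmod_scaleE scalerA. Qed.
Fact quotmod_scale1 : left_id 1 quotmod_scale.
Proof. by elim/quotmodW => x; rewrite quotmod_scaleE scale1r. Qed.
Fact quotmod_scaleDr : right_distributive quotmod_scale +%R.
Proof.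
move=> a; elim/quotmodW => x; elim/quotmodW => y.
by rewrite -quotmod_classD !quotmod_scaleE -quotmod_classD scalerDr.
Qed.
Fact quotmod_scaleDl q : {morph quotmod_scale^~ q : a b / a + b}.
Proof.
by elim/quotmodW: q => x a b; rewrite !quotmod_scaleE -quotmod_classD scalerDl.
Qed.
HB.instance Definition _ := GRing.Zmodule_isLmodule.Build R quotmod
  quotmod_scaleA quotmod_scale1 quotmod_scaleDr quotmod_scaleDl.

End QuotientModule.

Section ResidueField.
Variables (R : comNzRingType) (m : idealr R).

Definition resfield : Type := {ideal_quot m}.

HB.instance Definition _ := GRing.ComNzRing.on resfield.

Definition resfield_class (a : R) : resfield := \pi_{ideal_quot m} a.
Definition resfield_scale (a : R) (x : resfield) : resfield :=
  resfield_class a * x.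

Fact resfield_scaleA a b x :
  resfield_scale a (resfield_scale b x) = resfield_scale (a * b) x.
Proof.
by rewrite /resfield_scale mulrA; congr (_ * _); rewrite /resfield_class rmorphM.
Qed.
Fact resfield_scale1 : left_id 1 resfield_scale.
Proof. by move=> x; rewrite /resfield_scale /resfield_class rmorph1 mul1r. Qed.
Fact resfield_scaleDr : right_distributive resfield_scale +%R.
Proof. by move=> a x y; rewrite /resfield_scale mulrDr. Qed.
Fact resfield_scaleDl x : {morph resfield_scale^~ x : a b / a + b}.
Proof. by move=> a b; rewrite /resfield_scale /resfield_class rmorphD mulrDl. Qed.
HB.instance Definition _ := GRing.Zmodule_isLmodule.Build R resfield
  resfield_scaleA resfield_scale1 resfield_scaleDr resfield_scaleDl.

(* A k-vector space is an R-module killed by m, and k-linear maps are the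
   R-linear ones; so dim_k V = b means that V is isomorphic to k^b as an
   R-module.  Default value 0 if V is not a finite dimensional k-space. *)
Definition resfield_dim (V : lmodType R) : nat :=
  xget 0%N [set b : nat | lmod_iso V {ffun 'I_b -> resfield}].

End ResidueField.

(* Elements of U (x) V are formal sums of pure tensors; two formal sums are
   identified when every bilinear map on U x V takes the same value on them.
   [tensor_liftE] and [tensor_ext] below are the universal property. *)
Section Tensor.
Variables (R : comNzRingType) (U V : lmodType R).

Definition formal_value (W : lmodType R) (b : {bilinear U -> V -> W})
    (s : seq (U * V)) : W := \sum_(p <- s) b p.1 p.2.

Definition tensor_eq (s t : seq (U * V)) : bool :=
  `[< forall (W : lmodType R) (b : {bilinear U -> V -> W}),
        formal_value b s = formal_value b t >].

Fact tensor_eq_refl : reflexive tensor_eq.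
Proof. by move=> s; apply/asboolP. Qed.
Fact tensor_eq_sym : symmetric tensor_eq.
Proof. by move=> s t; apply/asboolP/asboolP => h W b; rewrite h. Qed.
Fact tensor_eq_trans : transitive tensor_eq.
Proof.
by move=> t s u /asboolP h1 /asboolP h2; apply/asboolP => W b; rewrite h1.
Qed.
Canonical tensor_equiv :=
  EquivRel tensor_eq tensor_eq_refl tensor_eq_sym tensor_eq_trans.

Definition tensor : Type := {eq_quot tensor_eq}.

HB.instance Definition _ := Choice.on tensor.
HB.instance Definition _ : EqQuotient _ tensor_eq tensor := EqQuotient.on tensor.

Definition tensor_class (s : seq (U * V)) : tensor := \pi_tensor s.
Definition pure_tensor (x : U) (y : V) : tensor := tensor_class [:: (x, y)].

Lemma tensor_classP s t : tensor_class s = tensor_class t <->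
  forall (W : lmodType R) (b : {bilinear U -> V -> W}),
    formal_value b s = formal_value b t.
Proof. by split=> [/eqmodP/asboolP//|h]; apply/eqmodP/asboolP. Qed.

Lemma tensorW (P : tensor -> Prop) :
  (forall s, P (tensor_class s)) -> forall z, P z.
Proof. by move=> h z; rewrite -[z]reprK; apply: h. Qed.

Lemma tensor_reprP (W : lmodType R) (b : {bilinear U -> V -> W}) s :
  formal_value b (repr (tensor_class s)) = formal_value b s.
Proof. by apply: (tensor_classP _ _).1; rewrite /tensor_class reprK. Qed.

Definition formal_scale (a : R) (s : seq (U * V)) :=
  [seq (a *: p.1, p.2) | p <- s].

Lemma formal_value_cat (W : lmodType R) (b : {bilinear U -> V -> W}) s t :
  formal_value b (s ++ t) = formal_value b s + formal_value b t.
Proof. by rewrite /formal_value big_cat. Qed.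
Lemma formal_value_scale (W : lmodType R) (b : {bilinear U -> V -> W}) a s :
  formal_value b (formal_scale a s) = a *: formal_value b s.
Proof.
rewrite /formal_value big_map scaler_sumr.
by apply: eq_bigr => p _; rewrite linearZl_LR.
Qed.

Definition tensor_zero : tensor := tensor_class [::].
Definition tensor_add (z w : tensor) : tensor := tensor_class (repr z ++ repr w).
Definition tensor_scale (a : R) (z : tensor) : tensor :=
  tensor_class (formal_scale a (repr z)).
Definition tensor_opp : tensor -> tensor := tensor_scale (-1).

Lemma tensor_addE s t :
  tensor_add (tensor_class s) (tensor_class t) = tensor_class (s ++ t).
Proof.
by apply/tensor_classP => W b; rewrite !formal_value_cat !tensor_reprP.
Qed.
Lemma tensor_scaleE a s :
  tensor_scale a (tensor_class s) = tensor_class (formal_scale a s).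
Proof.
by apply/tensor_classP => W b; rewrite !formal_value_scale tensor_reprP.
Qed.

Fact tensor_addA : associative tensor_add.
Proof.
elim/tensorW => s; elim/tensorW => t; elim/tensorW => u.
by rewrite !tensor_addE catA.
Qed.
Fact tensor_addC : commutative tensor_add.
Proof.
elim/tensorW => s; elim/tensorW => t; rewrite !tensor_addE.
by apply/tensor_classP => W b; rewrite !formal_value_cat addrC.
Qed.
Fact tensor_add0 : left_id tensor_zero tensor_add.
Proof. by elim/tensorW => s; rewrite tensor_addE. Qed.
Fact tensor_addN : left_inverse tensor_zero tensor_opp tensor_add.
Proof.
elim/tensorW => s; rewrite /tensor_opp tensor_scaleE tensor_addE.
apply/tensor_classP => W b.
by rewrite formal_value_cat formal_value_scale scaleN1r addNr /formal_value big_nil.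
Qed.
HB.instance Definition _ :=
  GRing.isZmodule.Build tensor tensor_addA tensor_addC tensor_add0 tensor_addN.

Fact tensor_scaleA a b z :
  tensor_scale a (tensor_scale b z) = tensor_scale (a * b) z.
Proof.
elim/tensorW: z => s; rewrite !tensor_scaleE.
by apply/tensor_classP => W c; rewrite !formal_value_scale scalerA.
Qed.
Fact tensor_scale1 : left_id 1 tensor_scale.
Proof.
elim/tensorW => s; rewrite tensor_scaleE.
by apply/tensor_classP => W c; rewrite formal_value_scale scale1r.
Qed.
Fact tensor_scaleDr : right_distributive tensor_scale +%R.
Proof.
move=> a; elim/tensorW => s; elim/tensorW => t.
rewrite [_ + _]tensor_addE !tensor_scaleE [RHS]tensor_addE.
by apply/tensor_classP => W c; rewrite !(formal_value_scale, formal_value_cat) scalerDr.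
Qed.
Fact tensor_scaleDl z : {morph tensor_scale^~ z : a b / a + b}.
Proof.
elim/tensorW: z => s a b; rewrite !tensor_scaleE [RHS]tensor_addE.
by apply/tensor_classP => W c; rewrite !(formal_value_scale, formal_value_cat) scalerDl.
Qed.
HB.instance Definition _ := GRing.Zmodule_isLmodule.Build R tensor
  tensor_scaleA tensor_scale1 tensor_scaleDr tensor_scaleDl.

Lemma tensor_classD s t :
  tensor_class (s ++ t) = tensor_class s + tensor_class t.
Proof. by rewrite -tensor_addE. Qed.

Fact pure_tensor_bilinear : bilinear_for *:%R *:%R pure_tensor.
Proof.
split=> [y a x x' | x a y y'] /=;
  rewrite [X in _ = X + _]tensor_scaleE -tensor_classD; apply/tensor_classP => W b;
  by rewrite /formal_value /= !big_cons big_nil ?addr0 /=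
             ?linearPl ?linearPr // linearZl_LR.
Qed.
HB.instance Definition _ :=
  bilinear_isBilinear.Build R U V tensor *:%R *:%R pure_tensor pure_tensor_bilinear.

Definition tensor_lift (W : lmodType R) (b : {bilinear U -> V -> W})
  (z : tensor) : W := formal_value b (repr z).

Fact tensor_lift_linear (W : lmodType R) (b : {bilinear U -> V -> W}) : linear (tensor_lift b).
Proof.
move=> a; elim/tensorW => s; elim/tensorW => t.
rewrite [a *: _]tensor_scaleE -tensor_classD /tensor_lift !tensor_reprP.
by rewrite formal_value_cat formal_value_scale.
Qed.
HB.instance Definition _ (W : lmodType R) (b : {bilinear U -> V -> W}) :=
  GRing.isLinear.Build R tensor W *:%R (tensor_lift b) (tensor_lift_linear b).

Lemma tensor_liftE (W : lmodType R) (b : {bilinear U -> V -> W}) x y :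
  tensor_lift b (pure_tensor x y) = b x y.
Proof. by rewrite /tensor_lift tensor_reprP /formal_value big_seq1. Qed.

Lemma tensor_ext (W : lmodType R) (f g : {linear tensor -> W}) :
  (forall x y, f (pure_tensor x y) = g (pure_tensor x y)) -> f =1 g.
Proof.
move=> fg; elim/tensorW; elim=> [|[x y] s IHs].
  by rewrite (_ : tensor_class [::] = 0) // !linear0.
by rewrite -cat1s tensor_classD !linearD IHs fg.
Qed.

End Tensor.

Section TensorMap.
Variables (R : comNzRingType) (U U' V : lmodType R) (f : {linear U -> U'}).

Definition map_pure_tensor (x : U) (y : V) : tensor U' V := pure_tensor (f x) y.

Fact map_pure_tensor_bilinear : bilinear_for *:%R *:%R map_pure_tensor.
Proof.
split=> [y a x x' | x a y y'] /=; rewrite /map_pure_tensor.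
  by rewrite linearP linearPl.
by rewrite linearPr.
Qed.
HB.instance Definition _ := bilinear_isBilinear.Build R U V (tensor U' V)
  *:%R *:%R map_pure_tensor map_pure_tensor_bilinear.

Definition tensor_map : {linear tensor U V -> tensor U' V} :=
  [the {linear tensor U V -> tensor U' V} of tensor_lift map_pure_tensor].

Lemma tensor_mapE x y : tensor_map (pure_tensor x y) = pure_tensor (f x) y.
Proof. exact: tensor_liftE. Qed.

End TensorMap.

(* Complexes concentrated in nonnegative degrees. *)
Record complex (R : comNzRingType) : Type := Complex {
  cobj :> nat -> lmodType R;
  cdiff : forall n, {linear cobj n.+1 -> cobj n};
  cdiffK : forall n x, cdiff n (cdiff n.+1 x) = 0 }.

Section Homology.
Variables (R : comNzRingType) (C : complex R).

Definition cycles (n : nat) : {pred C n} :=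
  match n return {pred C n} with
  | 0%N => predT
  | n'.+1 => fun x => cdiff C n' x == 0
  end.

Definition boundaries (n : nat) : {pred C n} :=
  fun x => `[< exists y, cdiff C n y = x >].

Fact cycles_closed n : subsemimod_closed (@cycles n).
Proof.
case: n => [|n]; first by [].
split; first split; rewrite ?unfold_in /=.
- by rewrite linear0.
- move=> x y; rewrite !unfold_in /= => /eqP x0 /eqP y0.
  by rewrite linearD x0 y0 addr0.
- by move=> a x; rewrite !unfold_in /= => /eqP x0; rewrite linearZ /= x0 scaler0.
Qed.
HB.instance Definition _ n :=
  GRing.isSubmodClosed.Build R (C n) (@cycles n) (cycles_closed n).

Definition boundary_cycles n : {pred submod (@cycles n)} :=
  fun z => val z \in @boundaries n.
Fact boundary_cycles_closed n : subsemimod_closed (@boundary_cycles n).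
Proof.
split; first split.
- by apply/asboolP; exists 0; rewrite !linear0.
- move=> x y /asboolP [x' x'E] /asboolP [y' y'E]; apply/asboolP.
  by exists (x' + y'); rewrite !linearD x'E y'E.
- move=> a x /asboolP [x' x'E]; apply/asboolP.
  by exists (a *: x'); rewrite !linearZ /= x'E.
Qed.
HB.instance Definition _ n := GRing.isSubmodClosed.Build R
  (submod (@cycles n)) (@boundary_cycles n) (boundary_cycles_closed n).

Definition homology (n : nat) : lmodType R := quotmod (@boundary_cycles n).

Definition exact_complex : Prop := forall n, zero_module (homology n).

End Homology.

Section HomComplex.
Variables (R : comNzRingType) (H : lmodType R) (C : complex R).

Fact hom_complexK n (g : Hom H (C n.+2)) :
  hom_post (cdiff C n) (hom_post (cdiff C n.+1) g) = 0.
Proof. by apply: Hom_ext => x /=; rewrite cdiffK. Qed.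
Definition hom_complex : complex R :=
  @Complex R (fun n => Hom H (C n))
    (fun n => [the {linear _ -> _} of hom_post (H := H) (cdiff C n)])
    hom_complexK.

End HomComplex.

Section TensorComplex.
Variables (R : comNzRingType) (C : complex R) (V : lmodType R).

Fact tensor_complexK n (z : tensor (C n.+2) V) :
  tensor_map V (cdiff C n) (tensor_map V (cdiff C n.+1) z) = 0.
Proof.
rewrite -[LHS]/((tensor_map V (cdiff C n) \o tensor_map V (cdiff C n.+1)) z).
rewrite -[RHS]/((\0 : {linear tensor (C n.+2) V -> tensor (C n) V}) z).
apply: tensor_ext => x y /=.
by rewrite !tensor_mapE cdiffK linear0l.
Qed.
Definition tensor_complex : complex R :=
  @Complex R (fun n => tensor (C n) V) (fun n => tensor_map V (cdiff C n))
    tensor_complexK.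

End TensorComplex.

(* A complex A together with A_0 -> M. *)
Record augmented (R : comNzRingType) (M : lmodType R) : Type := Augmented {
  aug_complex :> complex R;
  aug_map : {linear aug_complex 0%N -> M};
  aug_mapK : forall x, aug_map (cdiff aug_complex 0 x) = 0 }.

Section Augmentation.
Variables (R : comNzRingType) (M : lmodType R) (A : augmented M).

Definition plus_obj (n : nat) : lmodType R :=
  if n is n'.+1 then A n' else M.
Definition plus_diff (n : nat) : {linear plus_obj n.+1 -> plus_obj n} :=
  match n return {linear plus_obj n.+1 -> plus_obj n} with
  | 0%N => aug_map A
  | n'.+1 => cdiff A n'
  end.
Fact plus_diffK n x : plus_diff n (plus_diff n.+1 x) = 0.
Proof. by case: n x => [|n] x; [exact: aug_mapK | exact: cdiffK]. Qed.

(* A^+, with M placed in degree 0 and A_n in degree n+1 *)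
Definition plus_complex : complex R := Complex plus_diffK.

Definition is_resolution : Prop := exact_complex plus_complex.

Definition bounded : Prop :=
  exists n : nat, forall i, (n < i)%N -> zero_module (A i).

End Augmentation.

Definition projective_resolution (R : comNzRingType) (M : lmodType R)
    (P : augmented M) : Prop :=
  is_resolution P /\ forall n, projective (P n).

Definition finite_pdim (R : comNzRingType) (M : lmodType R) : Prop :=
  exists P : augmented M, projective_resolution P /\ bounded P.

Section Ext.
Variables (R : comNzRingType) (C : complex R) (N : lmodType R).

Definition is_cocycle n (f : Hom (C n) N) : Prop :=
  forall x, f (cdiff C n x) = 0.

Definition is_coboundary n : Hom (C n) N -> Prop :=
  match n return Hom (C n) N -> Prop with
  | 0%N => fun f => f = 0
  | n'.+1 => fun f => exists g : Hom (C n') N, forall x, f x = g (cdiff C n' x)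
  end.

End Ext.

(* Ext^n_R(M, N) = 0: the n-th cohomology of Hom_R(P, N) vanishes; this does
   not depend on the projective resolution P. *)
Definition Ext_zero (R : comNzRingType) (n : nat) (M N : lmodType R) : Prop :=
  forall P : augmented M, projective_resolution P ->
  forall f : Hom (P n) N, is_cocycle f -> is_coboundary f.

Definition totally_reflexive (R : comNzRingType) (G : lmodType R) : Prop :=
  [/\ fin_gen G,
      bijective (@biduality R G),
      forall i : nat, i <> 0%N -> Ext_zero i G R^o &
      forall i : nat, i <> 0%N -> Ext_zero i (dual G) R^o].

Definition G_resolution (R : comNzRingType) (M : lmodType R)
    (G : augmented M) : Prop :=
  is_resolution G /\ forall n, totally_reflexive (G n).

Definition finite_Gdim (R : comNzRingType) (M : lmodType R) : Prop :=
  exists G : augmented M, G_resolution G /\ bounded G.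

Definition proper_G_resolution (R : comNzRingType) (M : lmodType R)
    (G : augmented M) : Prop :=
  G_resolution G /\
  forall H : lmodType R, totally_reflexive H ->
    exact_complex (hom_complex H (plus_complex G)).

(* Tor^G_n(M, N) is computed from a chosen proper G-resolution of M; it is
   meaningful, and independent of the choice up to isomorphism, when M has
   one.  Junk value: the zero module. *)
Definition rel_Tor (R : comNzRingType) (n : nat) (M N : lmodType R)
    : lmodType R :=
  match pselect (exists G : augmented M, proper_G_resolution G) with
  | left h => homology (tensor_complex (projT1 (cid h)) N) n
  | right _ => {ffun 'I_0 -> R^o}
  end.

Definition rel_betti (R : comNzRingType) (m : idealr R) (n : nat)
    (M : lmodType R) : nat :=
  resfield_dim m (rel_Tor n M (resfield m)).

(* [\sum_(n \in A)] is the sum of a family with finite support (and 0 if the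
   support is infinite). *)
Definition G_Euler_char (R : comNzRingType) (m : idealr R) (M : lmodType R)
    : int :=
  \sum_(n \in [set: nat]) (-1) ^+ n * (rel_betti m n M)%:Z.

Section NonZeroDivisors.
Variable R : comNzRingType.

Record nzd : Type :=
  Nzd { nzd_val :> R; nzd_lreg : `[< GRing.lreg nzd_val >] }.

HB.instance Definition _ := [isSub for nzd_val].
HB.instance Definition _ := [Choice of nzd by <:].

Fact nzd1_subproof : `[< GRing.lreg (1 : R) >].
Proof. by apply/asboolP; apply: lreg1. Qed.
Definition nzd1 : nzd := Nzd nzd1_subproof.

Fact nzd_mul_subproof (s t : nzd) : `[< GRing.lreg (nzd_val s * nzd_val t) >].
Proof.
apply/asboolP; apply: lregM; apply/asboolP; exact: nzd_lreg.
Qed.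
Definition nzd_mul (s t : nzd) : nzd := Nzd (nzd_mul_subproof s t).

End NonZeroDivisors.

Section Localization.
Variables (R : comNzRingType) (M : lmodType R).

Definition frac_eq (p q : M * nzd R) : bool :=
  `[< exists u : nzd R,
        nzd_val u *: (nzd_val q.2 *: p.1) = nzd_val u *: (nzd_val p.2 *: q.1) >].

Fact frac_eq_refl : reflexive frac_eq.
Proof. by move=> p; apply/asboolP; exists (nzd1 R). Qed.
Fact frac_eq_sym : symmetric frac_eq.
Proof. by move=> p q; apply/asboolP/asboolP => -[u uE]; exists u. Qed.
Fact frac_eq_trans : transitive frac_eq.
Proof.
move=> [y t] [x s] [z w] /asboolP [u /= uE] /asboolP [v /= vE]; apply/asboolP.
exists (nzd_mul (nzd_mul u v) t) => /=.
rewrite !scalerA in uE vE *.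
transitivity ((nzd_val v * nzd_val w) *: ((nzd_val u * nzd_val t) *: x)).
  by rewrite scalerA; congr (_ *: _); ring.
rewrite uE scalerA.
transitivity ((nzd_val u * nzd_val s) *: ((nzd_val v * nzd_val w) *: y)).
  by rewrite scalerA; congr (_ *: _); ring.
by rewrite vE scalerA; congr (_ *: _); ring.
Qed.
Canonical frac_equiv :=
  EquivRel frac_eq frac_eq_refl frac_eq_sym frac_eq_trans.

(* U^{-1}M, for U the set of nonzerodivisors of R. *)
Definition loc : Type := {eq_quot frac_eq}.

HB.instance Definition _ := Choice.on loc.
HB.instance Definition _ : EqQuotient _ frac_eq loc := EqQuotient.on loc.

Definition frac (x : M) (s : nzd R) : loc := \pi_loc (x, s).
Definition loc_num (z : loc) : M := (repr z).1.
Definition loc_den (z : loc) : nzd R := (repr z).2.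

Lemma fracP x s y t : frac x s = frac y t <->
  exists u : nzd R, nzd_val u *: (nzd_val t *: x) = nzd_val u *: (nzd_val s *: y).
Proof. by split=> [/eqmodP/asboolP//|h]; apply/eqmodP/asboolP. Qed.

Lemma frac_num_den z : frac (loc_num z) (loc_den z) = z.
Proof. by rewrite /frac /loc_num /loc_den -surjective_pairing reprK. Qed.

Lemma locW (P : loc -> Prop) : (forall x s, P (frac x s)) -> forall z, P z.
Proof. by move=> h z; rewrite -(frac_num_den z). Qed.

Lemma frac_cancel u x s : frac (nzd_val u *: x) (nzd_mul u s) = frac x s.
Proof.
by apply/fracP; exists (nzd1 R); rewrite /= !scale1r !scalerA mulrC.
Qed.

Definition loc_add (z w : loc) : loc :=
  frac (nzd_val (loc_den w) *: loc_num z + nzd_val (loc_den z) *: loc_num w)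
       (nzd_mul (loc_den z) (loc_den w)).
Definition loc_opp (z : loc) : loc := frac (- loc_num z) (loc_den z).
Definition loc_zero : loc := frac 0 (nzd1 R).

Lemma loc_addE x s y t : loc_add (frac x s) (frac y t) =
  frac (nzd_val t *: x + nzd_val s *: y) (nzd_mul s t).
Proof.
rewrite /loc_add; set z := frac x s; set w := frac y t.
have /fracP [u uE] := frac_num_den z.
have /fracP [v vE] := frac_num_den w.
apply/fracP; exists (nzd_mul u v) => /=.
rewrite !scalerDr !scalerA in uE vE *; congr (_ + _).
  transitivity ((nzd_val v * nzd_val t * nzd_val (loc_den w)) *: ((nzd_val u * nzd_val s) *: loc_num z)).
    by rewrite scalerA; congr (_ *: _); ring.
  by rewrite uE scalerA; congr (_ *: _); ring.
transitivity ((nzd_val u * nzd_val s * nzd_val (loc_den z)) *: ((nzd_val v * nzd_val t) *: loc_num w)).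
  by rewrite scalerA; congr (_ *: _); ring.
by rewrite vE scalerA; congr (_ *: _); ring.
Qed.

Lemma loc_oppE x s : loc_opp (frac x s) = frac (- x) s.
Proof.
rewrite /loc_opp; set z := frac x s; have /fracP [u uE] := frac_num_den z.
by apply/fracP; exists u; rewrite !scalerN uE.
Qed.

Lemma nzd_mulA : associative (@nzd_mul R).
Proof. by move=> s t u; apply: val_inj; rewrite /= mulrA. Qed.
Lemma nzd_mulC : commutative (@nzd_mul R).
Proof. by move=> s t; apply: val_inj; rewrite /= mulrC. Qed.
Lemma nzd_mul1 : left_id (nzd1 R) (@nzd_mul R).
Proof. by move=> s; apply: val_inj; rewrite /= mul1r. Qed.

Fact loc_addA : associative loc_add.
Proof.
elim/locW => x s; elim/locW => y t; elim/locW => z u; rewrite !loc_addE /= nzd_mulA.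
congr frac; rewrite !scalerDr !scalerA addrA.
by congr (_ *: _ + _ *: _ + _ *: _); ring.
Qed.
Fact loc_addC : commutative loc_add.
Proof.
by elim/locW => x s; elim/locW => y t; rewrite !loc_addE nzd_mulC addrC.
Qed.
Fact loc_add0 : left_id loc_zero loc_add.
Proof.
by elim/locW => x s; rewrite loc_addE scaler0 add0r frac_cancel.
Qed.
Fact loc_addN : left_inverse loc_zero loc_opp loc_add.
Proof.
elim/locW => x s; rewrite loc_oppE loc_addE scalerN addNr; apply/fracP.
by exists (nzd1 R); rewrite !scaler0.
Qed.
HB.instance Definition _ :=
  GRing.isZmodule.Build loc loc_addA loc_addC loc_add0 loc_addN.

End Localization.

Section LocalizedScaling.
Variables (R : comNzRingType) (M : lmodType R).

Definition loc_scale (q : loc R^o) (z : loc M) : loc M :=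
  frac ((loc_num q : R) *: loc_num z) (nzd_mul (loc_den q) (loc_den z)).

Lemma loc_scaleE (a : R^o) s (x : M) t :
  loc_scale (frac a s) (frac x t) = frac ((a : R) *: x) (nzd_mul s t).
Proof.
rewrite /loc_scale; set q := frac a s; set z := frac x t.
have /fracP [u uE] := frac_num_den q.
have /fracP [v vE] := frac_num_den z.
apply/fracP; exists (nzd_mul u v) => /=.
have {}uE : nzd_val u * (nzd_val s * (loc_num q : R)) = nzd_val u * (nzd_val (loc_den q) * (a : R)).
  exact: uE.
rewrite !scalerA in vE *.
transitivity ((nzd_val u * (nzd_val s * (loc_num q : R))) *: ((nzd_val v * nzd_val t) *: loc_num z)).
  by rewrite scalerA; congr (_ *: _); ring.
by rewrite uE vE scalerA; congr (_ *: _); ring.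
Qed.

Lemma loc_scaleDr : right_distributive loc_scale +%R.
Proof.
elim/locW => a r; elim/locW => x s; elim/locW => y t.
rewrite [_ + _]loc_addE !loc_scaleE [RHS]loc_addE -(frac_cancel r); congr frac.
  by rewrite /= !scalerDr !scalerA; congr (_ *: _ + _ *: _); ring.
by apply: val_inj => /=; ring.
Qed.

Lemma loc_scaleDl z : {morph loc_scale^~ z : p q / p + q}.
Proof.
elim/locW: z => x r; elim/locW => a s; elim/locW => b t.
rewrite [_ + _]loc_addE !loc_scaleE [RHS]loc_addE -(frac_cancel r); congr frac.
  rewrite /= scalerDl scalerDr !scalerA; congr (_ *: _ + _ *: _); rewrite /GRing.scale /=; ring.
by apply: val_inj => /=; ring.
Qed.

Lemma loc_scale1 : left_id (frac (1 : R^o) (nzd1 R)) loc_scale.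
Proof. by elim/locW => x s; rewrite loc_scaleE scale1r nzd_mul1. Qed.

End LocalizedScaling.

Lemma loc_scaleA (R : comNzRingType) (M : lmodType R) :
  forall (p q : loc R^o) (z : loc M),
    loc_scale p (loc_scale q z) = loc_scale (loc_scale p q) z.
Proof.
elim/locW => a r; elim/locW => b s; elim/locW => x t.
rewrite (loc_scaleE b s x t) (loc_scaleE a r b s) !loc_scaleE nzd_mulA.
by rewrite scalerA.
Qed.

Section TotalFractions.
Variable R : comNzRingType.

(* U^{-1}R, with [loc_scale] on [loc R^o] as product. *)
Definition total_frac : Type := loc R^o.

HB.instance Definition _ := GRing.Zmodule.on total_frac.

Definition total_one : total_frac := frac (1 : R^o) (nzd1 R).
Definition total_mul : total_frac -> total_frac -> total_frac :=
  @loc_scale R R^o.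

Fact total_mulA : associative total_mul.
Proof. exact: loc_scaleA. Qed.
Fact total_mulC : commutative total_mul.
Proof.
elim/locW => a s; elim/locW => b t; rewrite /total_mul !loc_scaleE nzd_mulC.
by congr frac; apply: mulrC.
Qed.
Fact total_mul1 : left_id total_one total_mul.
Proof. exact: loc_scale1. Qed.
Fact total_mulDl : left_distributive total_mul +%R.
Proof. by move=> p q z; apply: loc_scaleDl. Qed.
Fact total_one_neq0 : total_one != 0.
Proof.
apply/eqP => /fracP [u]; rewrite !scale1r scaler0 => u0.
have /asboolP u_reg := nzd_lreg u.
suff : (1 : R) = 0 by move=> /eqP; rewrite oner_eq0.
apply: u_reg.
by rewrite mulr0; exact: u0.
Qed.
HB.instance Definition _ := GRing.Zmodule_isComNzRing.Build total_frac
  total_mulA total_mulC total_mul1 total_mulDl total_one_neq0.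

HB.instance Definition _ (M : lmodType R) :=
  GRing.Zmodule_isLmodule.Build total_frac (loc M)
    (@loc_scaleA R M) (@loc_scale1 R M) (@loc_scaleDr R M) (@loc_scaleDl R M).

End TotalFractions.

Definition has_rank (R : comNzRingType) (M : lmodType R) (r : nat) : Prop :=
  @lmod_iso (total_frac R) (loc M) 'rV[total_frac R]_r.

(* Main.v *)
Require Import Defs.
From HB Require Import structures.
From mathcomp Require Import all_boot all_order all_algebra.
From mathcomp Require Import ring_quotient generic_quotient sesquilinear.
From mathcomp Require Import boolp classical_sets fsbigop.
From mathcomp Require Import ring.

Set Implicit Arguments.
Unset Strict Implicit.
Unset Printing Implicit Defensive.

Import GRing.Theory.

Local Open Scope ring_scope.

(* Auslander-Buchweitz approximation: a module M of finite G-dimension fits into an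
   exact sequence 0 -> K -> G -> M -> 0 with G totally reflexive and K having a
   finite free resolution 0 -> R^(s_k) -> ... -> R^(s_0) -> K -> 0. Since Ext(H, R)
   vanishes for H totally reflexive, splicing yields a proper G-resolution, so that
   chi^G(M) = nu(G) - (s_0 - s_1 + ...), where nu(G) is the minimal number of
   generators of G. Ranks are additive and K has rank s_0 - s_1 + ..., so if M has
   rank then rank G = rank M + rank K, and chi^G(M) = rank M means nu(G) = rank G.
   Then the kernel of a minimal free cover of G is torsion, hence zero: G is free
   and M has a finite free resolution. Conversely, if pdim M is finite, G can be
   chosen free, and nu(G) = rank G. *)

(** * Linear maps and short exact sequences *)

(** The ring may have zero divisors, so ranks live over the total ring of fractions, which in
    general is not a field; the linear algebra of vector spaces is replaced by one fact. By prime
    avoidance over the finitely many maximal associated primes, the coordinates of a vector with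
    zero annihilator have a linear combination that is a nonzerodivisor. Hence an injection between
    free modules splits after localization. This is why the quotient of a module with rank by a
    submodule with rank has rank, and why a cover of a module of rank n by R^n has torsion kernel;
    that kernel lies in R^n, so it vanishes. The resolution of K enters chi^G only through an
    alternating sum, which is the same for a bounded complex and for its homology. Minimality
    matters for the cover of G alone, where it identifies nu(G) with the dimension of G tensored
    with k. *)

Section LinearRelations.
Variables (R : comNzRingType) (U V : lmodType R).

Lemma linear_ex (f : U -> V) : linear f -> exists g : {linear U -> V}, g =1 f.
Proof.
move=> fL.
by exists (HB.pack f (GRing.isLinear.Build R U V *:%R f fL) : {linear U -> V}).
Qed.

(** Maps into submodules or out of quotients are given by their graphs. Linearity of [L] and the
    condition at 0 make it single-valued: the difference of two values at x is a value at 0. *)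
Lemma lin_of_rel (L : U -> V -> Prop) :
  (forall x, exists y, L x y) ->
  (forall a x y x' y', L x y -> L x' y' -> L (a *: x + x') (a *: y + y')) ->
  (forall y, L 0 y -> y = 0) ->
  exists f : {linear U -> V}, forall x, L x (f x).
Proof.
move=> Ltot Llin L0; have [f fL] := choice Ltot.
have Luniq x y y' : L x y -> L x y' -> y = y'.
  move=> xy xy'; apply/eqP; rewrite -subr_eq0; apply/eqP/L0.
  have := Llin (-1) _ _ _ _ xy' xy; rewrite !scaleN1r addNr addrC.
  exact.
have [a x y|g gE] := @linear_ex f; last by exists g => x; rewrite gE.
by apply: (Luniq (a *: x + y)) => //; apply: Llin.
Qed.

Lemma iso_of_rel (L : U -> V -> Prop) :
  (forall x, exists y, L x y) ->
  (forall a x y x' y', L x y -> L x' y' -> L (a *: x + x') (a *: y + y')) ->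
  (forall y, L 0 y -> y = 0) ->
  (forall y, exists x, L x y) -> (forall x, L x 0 -> x = 0) ->
  lmod_iso U V.
Proof.
move=> Ltot Llin L0 Lsurj Linj.
have Luniq x y y' : L x y -> L x y' -> y = y'.
  move=> xy xy'; apply/eqP; rewrite -subr_eq0; apply/eqP/L0.
  have := Llin (-1) _ _ _ _ xy' xy; rewrite !scaleN1r addNr addrC.
  exact.
have Luniq' x x' y : L x y -> L x' y -> x = x'.
  move=> xy x'y; apply/eqP; rewrite -subr_eq0; apply/eqP/Linj.
  have := Llin (-1) _ _ _ _ x'y xy; rewrite !scaleN1r addNr addrC.
  exact.
have [f fL] := lin_of_rel Ltot Llin L0.
have [g gL] := choice Lsurj.
exists f, g => [x|y]; first exact: (Luniq' _ _ (f x)).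
exact: (Luniq (g y)).
Qed.

End LinearRelations.

Lemma lmod_isoP (R : comNzRingType) (U V : lmodType R) :
  lmod_iso U V <->
  exists f : {linear U -> V}, injective f /\ forall y, exists x, f x = y.
Proof.
split=> [[f [g fK gK]]|[f [finj fsurj]]].
  by exists f; split=> [|y]; [exact: can_inj fK | exists (g y)].
exists f; have [g gK] := choice fsurj; exists g => // x.
exact: finj.
Qed.

Lemma lmod_iso_sym (R : comNzRingType) (U V : lmodType R) :
  lmod_iso U V -> lmod_iso V U.
Proof.
case=> f [g fK gK].
have gL : linear g by move=> a x y; apply: (can_inj fK); rewrite linearP !gK.
have [h hE] := linear_ex gL; exists h.
by exists f => x; rewrite hE.
Qed.

Lemma lmod_iso_trans (R : comNzRingType) (U V W : lmodType R) :
  lmod_iso U V -> lmod_iso V W -> lmod_iso U W.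
Proof.
move=> [f fb] [g gb]; exists [the {linear U -> W} of g \o f].
exact: bij_comp.
Qed.

Lemma linear_inj (R : comNzRingType) (U V : lmodType R) (f : {linear U -> V}) :
  (forall x, f x = 0 -> x = 0) -> injective f.
Proof.
move=> f0 x y fxy; apply/eqP; rewrite -subr_eq0; apply/eqP/f0.
by rewrite linearB fxy subrr.
Qed.

Definition surj (A B : Type) (f : A -> B) := forall y, exists x, f x = y.

Section ShortExact.
Variable R : comNzRingType.
Implicit Types A B C D : lmodType R.

Definition ses A B C (i : {linear A -> B}) (p : {linear B -> C}) : Prop :=
  [/\ injective i, surj p & forall x, p x = 0 <-> exists y, i y = x].

Lemma ses_comp A B C (i : {linear A -> B}) (p : {linear B -> C}) (e : ses i p) x :
  p (i x) = 0.
Proof. by case: e => _ _ h; apply/h; exists x. Qed.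

Lemma ses_factor A B C D (i : {linear A -> B}) (p : {linear B -> C})
    (f : {linear B -> D}) :
  ses i p -> (forall x, f (i x) = 0) ->
  exists g : {linear C -> D}, forall x, g (p x) = f x.
Proof.
case=> _ psurj ker f0.
have [||y|g gE] := @lin_of_rel _ C D (fun c d => exists2 b, p b = c & f b = d).
- by move=> c; have [b bE] := psurj c; exists (f b), b.
- move=> a x y x' y' [b <- <-] [b' <- <-]; exists (a *: b + b') => //;
  by rewrite linearP.
- by case=> b /ker [x <-] <-.
exists g => x; have [b] := gE (p x) => pb <-.
have /ker [y yE] : p (b - x) = 0 by rewrite linearB pb subrr.
by apply/eqP; rewrite eq_sym -subr_eq0 -linearB -opprB -yE linearN f0 oppr0.
Qed.

Lemma ses_lift A B C D (i : {linear A -> B}) (p : {linear B -> C})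
    (f : {linear D -> B}) :
  ses i p -> (forall x, p (f x) = 0) ->
  exists g : {linear D -> A}, forall x, i (g x) = f x.
Proof.
case=> iinj _ ker f0.
have [x||y|g gE] := @lin_of_rel _ D A (fun d a => i a = f d).
- exact/ker.
- by move=> a x y x' y' h h'; rewrite !linearP h h'.
- by rewrite linear0 => h; apply: iinj; rewrite h linear0.
by exists g.
Qed.

Lemma kerp_closed B C (p : {linear B -> C}) :
  subsemimod_closed [pred x | p x == 0].
Proof.
split; first split; rewrite ?inE.
- by rewrite linear0.
- move=> x y; rewrite !inE /= => /eqP x0 /eqP y0.
  by rewrite linearD x0 y0 addr0.
- by move=> a x; rewrite !inE /= => /eqP x0; rewrite linearZ /= x0 scaler0.
Qed.

Definition kerp B C (p : {linear B -> C}) : submodClosed B :=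
  HB.pack (fun x : B => p x == 0)
    (GRing.isSubmodClosed.Build R B (fun x : B => p x == 0) (kerp_closed p)).

Lemma in_kerp B C (p : {linear B -> C}) x : (x \in kerp p) = (p x == 0).
Proof. by []. Qed.

Definition submod_incl B (S : submodClosed B) : {linear submod S -> B} :=
  [the {linear submod S -> B} of val].

Lemma submod_incl_inj B (S : submodClosed B) : injective (submod_incl S).
Proof. exact: val_inj. Qed.

Lemma ses_ker B C (p : {linear B -> C}) : surj p -> ses (submod_incl (kerp p)) p.
Proof.
move=> psurj; split=> //; first exact: submod_incl_inj.
move=> x; split=> [/eqP px0|[y <-]]; last exact/eqP/(valP y).
by exists (@SubMod R B (kerp p) x px0).
Qed.

Lemma imp_closed A B (i : {linear A -> B}) :
  subsemimod_closed (fun x => `[< exists y, i y = x >]).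
Proof.
split; first split.
- by apply/asboolP; exists 0; rewrite linear0.
- move=> x y /asboolP [x' <-] /asboolP [y' <-]; apply/asboolP.
  by exists (x' + y'); rewrite linearD.
- move=> a x /asboolP [x' <-]; apply/asboolP.
  by exists (a *: x'); rewrite linearZ.
Qed.

Definition imp A B (i : {linear A -> B}) : submodClosed B :=
  HB.pack (fun x : B => `[< exists y, i y = x >])
    (GRing.isSubmodClosed.Build R B (fun x : B => `[< exists y, i y = x >])
       (imp_closed i)).

Lemma quotmod_class_linear B (S : submodClosed B) : linear (@quotmod_class R B S).
Proof.
by move=> a x y; rewrite quotmod_classD -[in LHS]quotmod_scaleE.
Qed.

Definition quotmod_proj B (S : submodClosed B) : {linear B -> quotmod S} :=
  HB.pack (@quotmod_class R B S) (GRing.isLinear.Build R B (quotmod S) *:%R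
    (@quotmod_class R B S) (@quotmod_class_linear B S)).

Lemma quotmod_proj_surj B (S : submodClosed B) : surj (quotmod_proj S).
Proof. by elim/quotmodW => x; exists x. Qed.

Lemma quotmod_proj0 B (S : submodClosed B) x : quotmod_proj S x = 0 <-> x \in S.
Proof.
rewrite -(linear0 (quotmod_proj S)) -[x in _ <-> x \in _]subr0.
exact: quotmod_classP.
Qed.

Lemma ses_coker A B (i : {linear A -> B}) : injective i ->
  exists (C : lmodType R) (p : {linear B -> C}), ses i p.
Proof.
move=> iinj; exists (quotmod (imp i)), (quotmod_proj (imp i)).
split=> //; first exact: quotmod_proj_surj.
by move=> x; rewrite quotmod_proj0; split=> /asboolP.
Qed.

End ShortExact.

(** * Free modules of finite rank and finite generation *)

Section FreeModules.
Variable R : comNzRingType.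

Lemma rV_lin_ex n (V : lmodType R) (x : 'I_n -> V) :
  exists f : {linear 'rV[R]_n -> V},
    forall v : 'rV[R]_n, f v = \sum_i v ord0 i *: x i.
Proof.
have [a u v|f fE] := @linear_ex R _ V (fun v : 'rV[R]_n => \sum_i v ord0 i *: x i).
  rewrite scaler_sumr -big_split; apply: eq_bigr => i _.
  by rewrite !mxE scalerDl scalerA.
by exists f => v; rewrite fE.
Qed.

Lemma rV_lin_sum n (V : lmodType R) (f : {linear 'rV[R]_n -> V}) v :
  f v = \sum_i v ord0 i *: f (delta_mx ord0 i).
Proof.
rewrite {1}(row_sum_delta v) linear_sum; apply: eq_bigr => i _.
by rewrite linearZ.
Qed.

Lemma rV_projective n : projective 'rV[R]_n.
Proof.
move=> A B p f psurj.
have [y yE] := choice (fun i => psurj (f (delta_mx ord0 i))).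
have [g gE] := rV_lin_ex y; exists g => v /=.
rewrite gE linear_sum [RHS]rV_lin_sum; apply: eq_bigr => i _.
by rewrite linearZ yE.
Qed.

Lemma fin_genP (V : lmodType R) :
  fin_gen V <-> exists n (p : {linear 'rV[R]_n -> V}), surj p.
Proof.
split=> [[s sgen]|[n [p psurj]]].
  have [p pE] := rV_lin_ex (fun i : 'I_(size s) => s`_i).
  exists (size s), p => x; have /sgen [c ->] : x \in predT by [].
  exists (\row_i c i); rewrite pE; apply: eq_bigr => i _.
  by rewrite mxE.
exists [seq p (delta_mx ord0 i) | i <- enum 'I_n] => x; split=> // _.
have [v <-] := psurj x.
exists (fun i => if insub i is Some j then v ord0 j else 0).
rewrite size_map size_enum_ord rV_lin_sum; apply: eq_bigr => i _.
rewrite (nth_map i) ?size_enum_ord // nth_ord_enum.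
by case: insubP => [j _ /val_inj ->|/negP []].
Qed.

Lemma fin_gen_surj (U V : lmodType R) (p : {linear U -> V}) :
  surj p -> fin_gen U -> fin_gen V.
Proof.
move=> psurj /fin_genP [n [q qsurj]]; apply/fin_genP.
exists n, [the {linear 'rV[R]_n -> V} of p \o q] => y.
by have [x <-] := psurj y; have [z <-] := qsurj x; exists z.
Qed.

Lemma fin_gen_rV n : fin_gen 'rV[R]_n.
Proof.
by apply/fin_genP; exists n, [the {linear 'rV[R]_n -> 'rV[R]_n} of idfun] => y; exists y.
Qed.

Lemma projective_lift (P A B : lmodType R) (p : {linear A -> B})
    (f : {linear P -> B}) : projective P -> surj p ->
  exists g : {linear P -> A}, forall x, p (g x) = f x.
Proof. by move=> Pproj psurj; apply: Pproj. Qed.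

End FreeModules.

(** The types vary with the index, so that one principle builds ascending chains of ideals as well
    as families of maps between the terms of two complexes. *)
Lemma dep_choice (T : nat -> Type) (L : forall n, T n -> T n.+1 -> Prop)
    (t0 : T 0%N) : (forall n t, exists t', @L n t t') ->
  exists t : forall n, T n, t 0%N = t0 /\ forall n, L n (t n) (t n.+1).
Proof.
move=> Lex; pose step n t := sval (cid (Lex n t)).
exists (nat_rect T t0 step); split=> // n.
exact: svalP (cid (Lex n _)).
Qed.

(** * Noetherian and local rings *)

Section Ideals.
Variable R : comNzRingType.

Definition is_ideal (I : R -> Prop) : Prop :=
  I 0 /\ forall a x y, I x -> I y -> I (a * x + y).

Lemma is_ideal_sum (I : R -> Prop) (n : nat) (c s : 'I_n -> R) :
  is_ideal I -> (forall i, I (s i)) -> I (\sum_i c i * s i).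
Proof.
move=> [I0 IL] sI; apply: (big_ind I) => //.
- by move=> x y Ix Iy; rewrite -[x]mul1r; apply: IL.
- by move=> i _; rewrite -[_ * _]addr0; apply: IL.
Qed.

Lemma is_ideal_closed (I : R -> Prop) : is_ideal I ->
  subsemimod_closed (fun x : R^o => `[< I x >]).
Proof.
move=> [I0 IL]; split; first split.
- exact/asboolP.
- move=> x y /asboolP Ix /asboolP Iy; apply/asboolP.
  by rewrite -[x]mul1r; apply: IL.
- move=> a x /asboolP Ix; apply/asboolP.
  by rewrite -[_ *: _]addr0; apply: IL.
Qed.

Lemma ideal_fin_gen (I : R -> Prop) : noetherian R -> is_ideal I ->
  exists n (s : 'I_n -> R), (forall i, I (s i)) /\
    forall x, I x -> exists c : 'I_n -> R, x = \sum_i c i * s i.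
Proof.
move=> Rn II.
pose S : submodClosed R^o := HB.pack (fun x : R^o => `[< I x >])
  (GRing.isSubmodClosed.Build R R^o (fun x : R^o => `[< I x >])
    (is_ideal_closed II)).
have [s sgen] := Rn S; exists (size s), (fun i => s`_i); split.
  move=> i; apply/asboolP; apply/(sgen s`_i).
  exists (fun j : nat => (j == i)%:R); rewrite (bigD1 i) //= eqxx scale1r.
  rewrite big1 ?addr0 // => j ji.
  by rewrite (negPf ji : (j == i :> nat) = false) scale0r.
move=> x Ix; have /(sgen x) [c ->] : x \in S by apply/asboolP.
by exists (fun i => c i).
Qed.

(** Without a maximal member, dependent choice gives a strictly ascending chain. Its union is an
    ideal whose finitely many generators all lie in one member of the chain, so the next member
    cannot be larger. *)
Lemma ideal_acc (F : (R -> Prop) -> Prop) (I0 : R -> Prop) :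
  noetherian R -> F I0 -> (forall I, F I -> is_ideal I) ->
  exists2 I, F I & forall J, F J -> (forall a, I a -> J a) ->
    forall a, J a -> I a.
Proof.
move=> Rn FI0 Fid; apply: contrapT => nomax.
have step (I : {I | F I}) : exists J : {J | F J},
    (forall a, sval I a -> sval J a) /\ exists2 a, sval J a & ~ sval I a.
  apply: contrapT => noJ; apply: nomax; exists (sval I); first exact: (svalP I).
  move=> J FJ IJ a Ja; apply: contrapT => Ia; apply: noJ.
  by exists (exist _ J FJ); split=> //; exists a.
have [t [_ tL]] := @dep_choice (fun _ => {I | F I})
  (fun _ I J => (forall a, sval I a -> sval J a) /\ exists2 a, sval J a & ~ sval I a)
  (exist _ I0 FI0) (fun _ I => step I).
have tmono i j : (i <= j)%N -> forall a, sval (t i) a -> sval (t j) a.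
  move=> /subnK <-; elim: (j - i)%N => [|d IHd] a //= /IHd.
  exact: (tL _).1.
pose U a := exists i, sval (t i) a.
have tid i : is_ideal (sval (t i)) by apply: Fid; apply: (svalP (t i)).
have Uid : is_ideal U.
  split; first by exists 0%N; case: (tid 0%N).
  move=> a x y [i xi] [j yj]; exists (maxn i j).
  have [_ IL] := tid (maxn i j).
  apply: IL; [apply: (tmono i) | apply: (tmono j)] => //.
    exact: leq_maxl.
  exact: leq_maxr.
have [n [s [sU sgen]]] := ideal_fin_gen Rn Uid.
have [f fE] := choice sU.
pose N := (\max_i f i)%N.
have [_ [a ta nta]] := tL N.
have /sgen [c aE] : U a by exists N.+1.
apply: nta; rewrite aE; apply: is_ideal_sum => // i.
apply: (tmono (f i)) => //; exact: (leq_bigmax i).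
Qed.

End Ideals.

Section Noetherian.
Variable R : comNzRingType.
Implicit Types U V W : lmodType R.

(** Submodules enter as injective maps from arbitrary modules, so that kernels and fibre products
    can be used directly. *)
Definition noeth V : Prop :=
  forall (U : lmodType R) (i : {linear U -> V}), injective i -> fin_gen U.

Lemma fin_gen_ext U V W (i : {linear U -> V}) (p : {linear V -> W}) :
  ses i p -> fin_gen U -> fin_gen W -> fin_gen V.
Proof.
move=> e /fin_genP [a [f fsurj]] /fin_genP [b [g gsurj]].
have [iinj psurj ker] := e.
have [h hE] := projective_lift g (@rV_projective R b) psurj.
have [k kE] : exists k : {linear 'rV[R]_(a + b) -> V},
    forall x : 'rV_(a + b), k x = i (f (lsubmx x)) + h (rsubmx x).
  by apply: linear_ex => c x y; rewrite !linearP scalerDr addrACA.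
apply/fin_genP; exists (a + b)%N, k => x.
have [y yE] := gsurj (p x).
have /ker [u uE] : p (x - h y) = 0 by rewrite linearB hE yE subrr.
have [z zE] := fsurj u; exists (row_mx z y).
by rewrite kE row_mxKl row_mxKr zE uE subrK.
Qed.

Lemma image_factor V W (f : {linear V -> W}) :
  exists (Q : lmodType R) (q : {linear V -> Q}) (j : {linear Q -> W}),
    [/\ surj q, injective j & forall x, j (q x) = f x].
Proof.
have [||y|q qE] := @lin_of_rel R V (submod (imp f)) (fun x y => val y = f x).
- move=> x; have fx : f x \in imp f by apply/asboolP; exists x.
  by exists (SubMod fx).
- move=> a x y x' y' xy x'y'; rewrite (linearP f) -xy -x'y'.
  exact: (linearP (submod_incl (imp f))).
- rewrite linear0 => y0; apply: val_inj; rewrite y0.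
  exact/esym/(linear0 (submod_incl (imp f))).
exists (submod (imp f) : lmodType R), q, (submod_incl (imp f)); split=> [||//].
  move=> y; have /asboolP [x xE] := valP y; exists x.
  by apply: val_inj; rewrite qE.
exact: submod_incl_inj.
Qed.

(** A submodule of V is an extension of its image in W by a kernel that embeds into U. *)
Lemma noeth_ext U V W (i : {linear U -> V}) (p : {linear V -> W}) :
  ses i p -> noeth U -> noeth W -> noeth V.
Proof.
move=> e Un Wn A j jinj.
have [Q [q [k [qsurj kinj kE]]]] := image_factor [the {linear A -> W} of p \o j].
apply: (fin_gen_ext (ses_ker qsurj)); last exact: Wn kinj.
have [x|l lE] := @ses_lift R _ _ _ _ _ _
    [the {linear submod (kerp q) -> V} of j \o submod_incl (kerp q)] e.
  rewrite -[LHS]kE.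
  by have /eqP -> := valP x; rewrite linear0.
apply: (Un _ l) => x y lxy; apply: val_inj; apply: jinj.
by rewrite -[LHS]lE -[RHS]lE lxy.
Qed.

(** A submodule A of W is a quotient of its preimage in V, realized here as the fibre product of V
    and A over W. *)
Lemma noeth_surj V W (p : {linear V -> W}) : surj p -> noeth V -> noeth W.
Proof.
move=> psurj Vn A j jinj.
have [c cE] := choice psurj.
pose P : {linear (V * A)%type -> W} :=
  [the {linear (V * A)%type -> W} of (p \o fst) \- (j \o snd)].
pose K := submod (kerp P).
have KP (x : K) : p (val x).1 = j (val x).2.
  by apply/eqP; rewrite -subr_eq0; apply: (valP x).
apply: (@fin_gen_surj R K A [the {linear K -> A} of snd \o submod_incl (kerp P)]).
  move=> y; have h : (c (j y), y) \in kerp P by rewrite in_kerp /= cE subrr.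
  by exists (SubMod h).
apply: (Vn K [the {linear K -> V} of fst \o submod_incl (kerp P)]).
apply: linear_inj => x x0; apply: val_inj.
apply: injective_projections => //.
by apply: jinj; rewrite -KP [(val x).1]x0 !linear0.
Qed.

Hypothesis Rn : noetherian R.

Lemma noeth_ring : noeth (R^o : lmodType R).
Proof.
move=> A i iinj.
have [|n [s [sI sgen]]] := @ideal_fin_gen R (fun x => exists y, i y = x) Rn.
  split; first by exists 0; rewrite linear0.
  move=> a x y [x' <-] [y' <-]; exists (a *: x' + y').
  by rewrite linearP.
have [t tE] := choice sI.
have [p pE] := rV_lin_ex t.
apply/fin_genP; exists n, p => y.
have [|c cE] := sgen (i y); first by exists y.
exists (\row_k c k); apply: iinj; rewrite pE cE linear_sum.
by apply: eq_bigr => k _; rewrite mxE linearZ tE.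
Qed.

Lemma noeth_rV n : noeth 'rV[R]_n.
Proof.
elim: n => [|n IHn].
  move=> A i iinj; apply/fin_genP.
  have [p pE] := rV_lin_ex (fun _ : 'I_0 => 0 : A).
  exists 0%N, p => y; exists 0; apply: iinj.
  by apply/rowP; case.
have [i iE] : exists i : {linear 'rV[R]_n -> 'rV[R]_(1 + n)},
    forall x, i x = row_mx 0 x.
  by apply: linear_ex => a x y; rewrite scale_row_mx add_row_mx scaler0 addr0.
have [p pE] : exists p : {linear 'rV[R]_(1 + n) -> R^o},
    forall x, p x = x ord0 (lshift n ord0).
  by apply: linear_ex => a x y; rewrite !mxE.
apply: (@noeth_ext _ _ _ i p _ IHn noeth_ring); split.
- by move=> x y; rewrite !iE => /eq_row_mx [].
- by move=> y; exists (row_mx (\row__ y) 0); rewrite pE row_mxEl mxE.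
- move=> x; split=> [x0|[y <-]]; last by rewrite pE iE row_mxEl mxE.
  exists (rsubmx x); rewrite iE -[RHS]hsubmxK; congr row_mx.
  apply/rowP => j; rewrite !mxE [j]ord1 -[LHS]x0 pE; congr (x _ _).
Qed.

Lemma fin_gen_noeth V : fin_gen V -> noeth V.
Proof. by move=> /fin_genP [n [p psurj]]; apply: (noeth_surj psurj); apply: noeth_rV. Qed.

Lemma fin_gen_sub U V (i : {linear U -> V}) : injective i -> fin_gen V -> fin_gen U.
Proof. by move=> iinj Vfg; apply: (fin_gen_noeth Vfg) iinj. Qed.

End Noetherian.

Section Local.
Variables (R : comNzRingType) (m : idealr R).
Hypotheses (Rn : noetherian R) (Rl : local_ring m).

(** If [a] is not a unit, some ideal is maximal among those that contain [a] but not 1; the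
    noetherian condition provides it. It is a maximal ideal, so it equals [m]. *)
Lemma local_unit a : a \notin m -> exists b, b * a = 1.
Proof.
move=> am; apply: contrapT => anu.
pose F (I : R -> Prop) := [/\ is_ideal I, I a & ~ I 1].
have [||I [Iid Ia I1] Imax] := @ideal_acc R F (fun x => exists b, b * a = x) Rn.
- split=> //; last by exists 1; rewrite mul1r.
  split; first by exists 0; rewrite mul0r.
  by move=> c x y [b <-] [d <-]; exists (c * b + d); rewrite mulrDl mulrA.
- by move=> J [].
have Icl : idealr_closed (fun x : R => `[< I x >]).
  case: Iid => I0 IL; split; rewrite ?unfold_in; first exact/asboolP.
    exact/asboolP.
  by move=> c x y /asboolP Ix /asboolP Iy; apply/asboolP; apply: IL.
pose J : idealr R := HB.pack (fun x : R => `[< I x >])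
  (isIdealr.Build R (fun x : R => `[< I x >]) Icl).
have Jmax : maximal_ideal J.
  move=> J' JJ' x; apply/idP/idP => [xJ'|/JJ' //]; apply/asboolP.
  apply: (Imax (fun x => x \in J')) => //; last by move=> y Iy; apply/JJ'/asboolP.
  split; last by rewrite idealr1.
  - split; first exact: idealr0.
    by move=> c y z yJ zJ; rewrite rpredD // idealMr.
  - exact/JJ'/asboolP.
have := Rl.2 J Jmax a; rewrite (negPf am) => /negP; apply.
exact/asboolP.
Qed.

(** Minimality is stated as: the kernel lies in m R^n. In this form it makes coordinates modulo m
    well defined on M. *)
Definition minimal_cover (M : lmodType R) n (p : {linear 'rV[R]_n -> M}) : Prop :=
  surj p /\ forall v, p v = 0 -> forall i, v ord0 i \in m.

(** With the least number of generators, a kernel vector cannot have a unit coordinate, since the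
    corresponding generator would be redundant. *)
Lemma minimal_cover_ex (M : lmodType R) : fin_gen M ->
  exists n (p : {linear 'rV[R]_n -> M}), minimal_cover p.
Proof.
move=> /fin_genP Mfg.
have ex : exists n, `[< exists p : {linear 'rV[R]_n -> M}, surj p >].
  by case: Mfg => n np; exists n; apply/asboolP.
case: (ex_minnP ex) => n /asboolP [p psurj] nmin; exists n, p; split=> // v pv i.
apply: contraT => /local_unit [b bE].
case: n p v i psurj nmin pv bE {ex} => [|n] p v i psurj nmin pv bE; first by case: i bE.
suff /nmin : `[< exists q : {linear 'rV[R]_n -> M}, surj q >] by rewrite ltnn.
have [q qE] := rV_lin_ex (fun j => p (delta_mx ord0 (lift i j))).
apply/asboolP; exists q => x; have [w <-] := psurj x.
(* Subtracting this multiple of the kernel vector [v] makes coordinate [i] zero and leaves the image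
   under [p] unchanged. *)
pose w' := w - (w ord0 i * b) *: v.
exists (\row_j w' ord0 (lift i j)); rewrite qE.
have -> : p w = p w' by rewrite linearB linearZ /= pv scaler0 subr0.
rewrite [RHS]rV_lin_sum (bigD1_ord i) //= {3}/w' !mxE -mulrA bE mulr1 subrr scale0r add0r.
by apply: eq_bigr => j _; rewrite mxE.
Qed.

End Local.

(** * Complexes, comparison maps and homotopies *)

Section Exactness.
Variable R : comNzRingType.
Implicit Types (C D : complex R) (M H P : lmodType R).

Lemma homology_class0 C n (x : submod (@cycles R C n)) :
  quotmod_class (@boundary_cycles R C n) x = 0 <->
  exists y, cdiff C n y = val x.
Proof. by split=> [/quotmod_proj0/asboolP|?] //; apply/quotmod_proj0/asboolP. Qed.

Lemma exact_complexP C :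
  exact_complex C <-> forall n x, x \in @cycles R C n -> exists y, cdiff C n y = x.
Proof.
split=> [ex n x xZ|ex n].
  by have := ex n (quotmod_class (@boundary_cycles R C n) (SubMod xZ)); rewrite homology_class0.
by elim/quotmodW => x; apply/homology_class0/ex/valP.
Qed.

Lemma cycles_hom H C n (f : hom_complex H C n) :
  f \in @cycles R (hom_complex H C) n <-> forall y, (f : {linear H -> C n}) y \in @cycles R C n.
Proof.
case: n f => [|n] f //; split=> [/eqP f0 y|f0].
  apply/eqP; rewrite -[LHS]/((hom_post (cdiff C n) f : {linear H -> C n}) y).
  by rewrite [hom_post _ _]f0.
by apply/eqP/Hom_ext => y; apply/eqP/f0.
Qed.

Lemma boundary_cycle C n x : cdiff C n x \in @cycles R C n.
Proof. by case: n x => [|n] x //; apply/eqP/cdiffK. Qed.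

(** The common hypothesis for comparison maps and homotopies: projective modules lift against exact
    complexes, totally reflexive ones against augmented proper G-resolutions. *)
Definition lifts H C : Prop := forall n (f : {linear H -> C n}),
  (forall y, f y \in @cycles R C n) ->
  exists g : {linear H -> C n.+1}, forall y, cdiff C n (g y) = f y.

Lemma exact_hom_complexP H C : exact_complex (hom_complex H C) <-> lifts H C.
Proof.
split=> [/exact_complexP ex n f fZ|hlift].
  have [|g gE] := ex n f; first exact/cycles_hom.
  by exists g => y; rewrite -gE.
apply/exact_complexP => n f /cycles_hom /hlift [g gE].
by exists g; apply: Hom_ext => y; apply: gE.
Qed.

Lemma projective_lifts P C : projective P -> exact_complex C -> lifts P C.
Proof.
move=> Pproj /exact_complexP ex n f fZ.
have [||y|d dE] := @lin_of_rel R (C n.+1) (submod (@cycles R C n))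
    (fun x z => val z = cdiff C n x).
- by move=> x; exists (SubMod (boundary_cycle x)).
- move=> a x z x' z' h h'; rewrite linearP -h -h'.
  exact: (linearP (submod_incl (@cycles R C n))).
- rewrite linear0 => y0; apply: val_inj; rewrite y0.
  exact/esym/(linear0 (submod_incl (@cycles R C n))).
have [||z|e eE] := @lin_of_rel R P (submod (@cycles R C n))
    (fun x z => val z = f x).
- by move=> x; exists (SubMod (fZ x)).
- move=> a x z x' z' h h'; rewrite linearP -h -h'.
  exact: (linearP (submod_incl (@cycles R C n))).
- rewrite linear0 => z0; apply: val_inj; rewrite z0.
  exact/esym/(linear0 (submod_incl (@cycles R C n))).
have [|g gE] := @projective_lift R P _ _ d e Pproj.
  move=> z; have [y yE] := ex n (val z) (valP z).
  by exists y; apply: val_inj; rewrite dE.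
by exists g => y; rewrite -eE -gE dE.
Qed.

End Exactness.

Section Comparison.
Variable R : comNzRingType.
Implicit Types C D : complex R.

Definition chain_map C D (f : forall n, {linear C n -> D n}) : Prop :=
  forall n x, cdiff D n (f n.+1 x) = f n (cdiff C n x).

(** Degree 0 is prescribed because the complexes of interest are augmented: their bottom term is the
    resolved module, on which the map is already known. *)
Lemma chain_map_ex C D (f0 : {linear C 0%N -> D 0%N}) :
  (forall n, lifts (C n.+1) D) ->
  exists f : forall n, {linear C n -> D n}, f 0%N = f0 /\ chain_map f.
Proof.
move=> hlift.
(* Each map carries the invariant that permits the next lift. *)
pose T n := {f : {linear C n -> D n} | forall y, f (cdiff C n y) \in @cycles R D n}.
have t0 : forall y, f0 (cdiff C 0 y) \in @cycles R D 0 by [].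
have [n [f fZ]|t [tE tL]] := @dep_choice T (fun n f g =>
    forall x, cdiff D n (sval g x) = sval f (cdiff C n x)) (exist _ f0 t0).
  have [g gE] := hlift n n [the {linear C n.+1 -> D n} of f \o cdiff C n] fZ.
  have gZ y : g (cdiff C n.+1 y) \in @cycles R D n.+1.
    by apply/eqP; rewrite gE /= cdiffK linear0.
  by exists (exist _ g gZ).
exists (fun n => sval (t n)); split=> [|n x]; first by rewrite tE.
exact: tL.
Qed.

Lemma homotopy_ex C D (u : forall n, {linear C n -> D n}) :
  (forall n, lifts (C n.+1) D) -> chain_map u -> (forall x, u 0%N x = 0) ->
  exists h : forall n, {linear C n -> D n.+1},
    (forall x, h 0%N x = 0) /\
    forall n x, u n.+1 x = cdiff D n.+1 (h n.+1 x) + h n (cdiff C n x).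
Proof.
move=> hlift uC u0.
(* The invariant says that u_(n+1) - h_n d takes values in cycles, hence lifts to the next piece of
   the homotopy. *)
pose T n := {h : {linear C n -> D n.+1} |
               forall x, cdiff D n (h (cdiff C n x)) = u n (cdiff C n x)}.
have t0 : forall x, cdiff D 0 ((\0 : {linear C 0%N -> D 1%N}) (cdiff C 0 x)) =
    u 0%N (cdiff C 0 x) by move=> x; rewrite u0 linear0.
have [n [h hE]|t [tE tL]] := @dep_choice T (fun n f g =>
    forall x, cdiff D n.+1 (sval g x) = u n.+1 x - sval f (cdiff C n x)) (exist _ _ t0).
  have [|g gE] := hlift n n.+1 [the {linear C n.+1 -> D n.+1} of u n.+1 \- (h \o cdiff C n)].
    by move=> y; apply/eqP; rewrite /= linearB hE uC subrr.
  have gE' x : cdiff D n.+1 (g (cdiff C n.+1 x)) = u n.+1 (cdiff C n.+1 x).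
    by rewrite gE /= cdiffK linear0 subr0.
  by exists (exist _ g gE').
exists (fun n => sval (t n)); split=> [x|n x]; first by rewrite tE.
by rewrite tL subrK.
Qed.

End Comparison.

Section Resolutions.
Variable R : comNzRingType.
Implicit Types (M : lmodType R) (N : lmodType R).

Definition chain_homotopy (C D : complex R) (u : forall n, {linear C n -> D n})
    (h : forall n, {linear C n -> D n.+1}) : Prop :=
  (forall x, u 0%N x = cdiff D 0 (h 0%N x)) /\
  forall n x, u n.+1 x = cdiff D n.+1 (h n.+1 x) + h n (cdiff C n x).

Definition homotopy_equiv (C D : complex R) : Prop :=
  exists (f : forall n, {linear C n -> D n}) (g : forall n, {linear D n -> C n})
    (h : forall n, {linear C n -> C n.+1}) (k : forall n, {linear D n -> D n.+1}),
    [/\ chain_map f, chain_map g,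
        chain_homotopy (fun n => [the {linear C n -> C n} of (g n \o f n) \- idfun]) h &
        chain_homotopy (fun n => [the {linear D n -> D n} of (f n \o g n) \- idfun]) k].

Lemma resolution_maps M (A B : augmented M) :
  (forall n, lifts (A n) (plus_complex B)) ->
  exists2 f : forall n, {linear A n -> B n}, chain_map f &
    forall x, aug_map B (f 0%N x) = aug_map A x.
Proof.
move=> hlift.
have [|f [f0 fC]] := @chain_map_ex R (plus_complex A) (plus_complex B)
   [the {linear M -> M} of idfun]; first by move=> n; apply: hlift.
exists (fun n => f n.+1) => [n x|x]; first exact: (fC n.+1).
by have := fC 0%N x; rewrite f0.
Qed.

Lemma resolution_homotopy M (A : augmented M) (u : forall n, {linear A n -> A n}) :
  (forall n, lifts (A n) (plus_complex A)) -> chain_map u ->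
  (forall x, aug_map A (u 0%N x) = 0) ->
  exists h, chain_homotopy u h.
Proof.
move=> hlift uC u0.
(* With the zero map on M, the family [u] becomes a chain map of the augmented complex that vanishes
   in degree 0; the homotopy vanishes on M and restricts to A. *)
pose v n : {linear plus_complex A n -> plus_complex A n} :=
  match n with 0%N => [the {linear M -> M} of \0] | n'.+1 => u n' end.
have [|||h [h0 hE]] := @homotopy_ex R _ (plus_complex A) v.
- by move=> n; apply: hlift.
- by case=> [|n] x /=; [apply: u0 | apply: uC].
- by [].
exists (fun n => h n.+1); split=> [x|n x]; last exact: (hE n.+1).
by have := hE 0%N x; rewrite h0 addr0.
Qed.

Lemma resolution_homotopy_equiv M (A B : augmented M) :
  (forall n, lifts (A n) (plus_complex A)) ->
  (forall n, lifts (A n) (plus_complex B)) ->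
  (forall n, lifts (B n) (plus_complex A)) ->
  (forall n, lifts (B n) (plus_complex B)) -> homotopy_equiv A B.
Proof.
move=> AA AB BA BB.
have [f fC f0] := resolution_maps AB; have [g gC g0] := resolution_maps BA.
have [||h hE] := @resolution_homotopy M A
    (fun n => [the {linear A n -> A n} of (g n \o f n) \- idfun]) AA.
- by move=> n x /=; rewrite linearB gC fC.
- by move=> x /=; rewrite linearB g0 f0 subrr.
have [||k kE] := @resolution_homotopy M B
    (fun n => [the {linear B n -> B n} of (f n \o g n) \- idfun]) BB.
- by move=> n x /=; rewrite linearB fC gC.
- by move=> x /=; rewrite linearB f0 g0 subrr.
by exists f, g, h, k.
Qed.

(** If u g = v d on D, then g f - 1 = d h + h d and u d = 0 give u = (v f - u h) d on C. *)
Lemma cocycle_homotopy_equiv N (C D : complex R) n :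
  homotopy_equiv C D ->
  (forall f : Defs.Hom (D n) N, is_cocycle f -> is_coboundary f) ->
  forall f : Defs.Hom (C n) N, is_cocycle f -> is_coboundary f.
Proof.
move=> [f [g [h [_ [fC gC [h0 hS] _]]]]] Dn u uZ.
have /Dn : is_cocycle
    ([the {linear D n -> N} of (u : {linear C n -> N}) \o g n] : Defs.Hom (D n) N).
  by move=> x /=; rewrite -gC uZ.
case: n h0 hS u uZ {Dn} => [|n] h0 hS u uZ /=.
  move=> ug0; apply: Hom_ext => x /=.
  have /(congr1 (fun w : Defs.Hom (D 0%N) N => (w : {linear D 0%N -> N}) (f 0%N x))) /= := ug0.
  have := congr1 (u : {linear C 0%N -> N}) (h0 x).
  by rewrite /= uZ linearB => /eqP; rewrite subr_eq0 => /eqP ->.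
case=> v vE.
exists ([the {linear C n -> N} of ((v : {linear D n -> N}) \o f n) \-
  ((u : {linear C n.+1 -> N}) \o h n)] : Defs.Hom (C n) N).
move=> x /=; rewrite -fC -vE /=.
have := congr1 (u : {linear C n.+1 -> N}) (hS n x).
rewrite /= linearB linearD uZ add0r => <-.
by rewrite opprB addrC subrK.
Qed.

(** [Ext_zero] speaks of every projective resolution; they are all homotopy equivalent, so one of
    them decides. *)
Lemma Ext_zero_resolution M N (A : augmented M) n :
  projective_resolution A ->
  (forall f : Defs.Hom (A n) N, is_cocycle f -> is_coboundary f) -> Ext_zero n M N.
Proof.
move=> [Ares Aproj] An P [Pres Pproj]; apply: cocycle_homotopy_equiv An.
by apply: resolution_homotopy_equiv => i; apply: projective_lifts.
Qed.

End Resolutions.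

(** * Resolutions and vanishing of Ext *)

Section Splice.
Variables (R : comNzRingType) (K G M : lmodType R).
Variables (i : {linear K -> G}) (p : {linear G -> M}) (ip : ses i p).
Variable A : augmented K.

Definition splice_obj (n : nat) : lmodType R := if n is n'.+1 then A n' else G.
Definition splice_diff (n : nat) : {linear splice_obj n.+1 -> splice_obj n} :=
  match n return {linear splice_obj n.+1 -> splice_obj n} with
  | 0%N => [the {linear A 0%N -> G} of i \o aug_map A]
  | n'.+1 => cdiff A n'
  end.
Fact splice_diffK n x : splice_diff n (splice_diff n.+1 x) = 0.
Proof. by case: n x => [|n] x; rewrite /= ?aug_mapK ?linear0 ?cdiffK. Qed.
Definition splice_complex : complex R := Complex splice_diffK.
Fact splice_aug0 x : p (cdiff splice_complex 0 x) = 0.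
Proof. exact: ses_comp ip _. Qed.
Definition splice : augmented M := @Augmented R M splice_complex p splice_aug0.

Lemma splice_resolution : is_resolution A -> is_resolution splice.
Proof.
case: ip => iinj psurj ker /exact_complexP Aex; apply/exact_complexP.
case=> [|[|[|n]]] x; first by move=> _; apply: psurj.
- move=> /eqP /ker [k <-]; have [|a aE] := Aex 0%N k; first by [].
  by exists a; rewrite /= -aE.
- move=> /eqP x0; apply: (Aex 1%N x); apply/eqP; apply: iinj.
  by rewrite linear0.
- exact: (Aex n.+2 x).
Qed.

End Splice.

Section Tail.
Variables (R : comNzRingType) (M : lmodType R) (A : augmented M).

Lemma tail_ex : is_resolution A -> exists B : augmented (submod (kerp (aug_map A))),
  is_resolution B /\ forall n, B n = A n.+1.
Proof.
move=> /exact_complexP Aex.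
have [x|a aE] := ses_lift (f := cdiff A 0) (ses_ker (Aex 0%N ^~ isT)).
  exact: aug_mapK.
have aK x : a (cdiff A 1 x) = 0.
  by apply: val_inj; rewrite [LHS]aE cdiffK.
pose B : augmented (submod (kerp (aug_map A))) :=
  @Augmented R _ (@Complex R (fun n => A n.+1) (fun n => cdiff A n.+1)
    (fun n => @cdiffK R A n.+1)) a aK.
exists B; split=> //; apply/exact_complexP.
case=> [|[|n]] x; last exact: (Aex n.+3 x).
- move=> _; have [y yE] := Aex 1%N (val x) (valP x).
  by exists y; apply: val_inj; rewrite [LHS]aE.
- move=> /eqP x0; apply: (Aex 2%N x); apply/eqP.
  by rewrite -[LHS]aE [a x]x0.
Qed.

End Tail.

Section FreeSyzygies.
Variable R : comNzRingType.

(** One step of a free resolution that stays inside a class [C] of modules. The predicate [good] is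
    trivial for arbitrary resolutions and is minimality of the cover for minimal ones. *)
Record free_cover (C : lmodType R -> Prop)
    (good : forall (M : lmodType R) n, {linear 'rV[R]_n -> M} -> Prop)
    (M : lmodType R) : Type := FreeCover {
  fc_n : nat;
  fc_K : lmodType R;
  fc_i : {linear fc_K -> 'rV[R]_fc_n};
  fc_p : {linear 'rV[R]_fc_n -> M};
  fc_ses : ses fc_i fc_p;
  fc_good : good M fc_n fc_p;
  fc_in : C fc_K }.

Variables (C : lmodType R -> Prop)
  (good : forall (M : lmodType R) n, {linear 'rV[R]_n -> M} -> Prop).
Hypothesis cover : forall M, C M -> inhabited (free_cover C good M).
Variables (M : lmodType R) (CM : C M).

Definition syz_state : Type := {Z : lmodType R | C Z}.
Definition syz_cover (t : syz_state) : free_cover C good (sval t) :=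
  inhabited_witness (cover (svalP t)).
Definition syz_next (t : syz_state) : syz_state :=
  exist _ (fc_K (syz_cover t)) (fc_in (syz_cover t)).
Definition syz_at (n : nat) : syz_state := iter n syz_next (exist _ M CM).
Definition syz (n : nat) : lmodType R := sval (syz_at n).
Definition syz_n (n : nat) : nat := fc_n (syz_cover (syz_at n)).
Definition syz_p (n : nat) : {linear 'rV[R]_(syz_n n) -> syz n} :=
  fc_p (syz_cover (syz_at n)).
Definition syz_i (n : nat) : {linear syz n.+1 -> 'rV[R]_(syz_n n)} :=
  fc_i (syz_cover (syz_at n)).

Lemma syz_ses n : ses (syz_i n) (syz_p n).
Proof. exact: fc_ses. Qed.

Lemma syz_in n : C (syz n).
Proof. exact: svalP. Qed.

Lemma syz_good n : good (syz_p n).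
Proof. exact: fc_good. Qed.

Definition syz_diff (n : nat) : {linear 'rV[R]_(syz_n n.+1) -> 'rV[R]_(syz_n n)} :=
  [the {linear _ -> _} of syz_i n \o syz_p n.+1].
Fact syz_diffK n x : syz_diff n (syz_diff n.+1 x) = 0.
Proof. by rewrite /= (ses_comp (syz_ses n.+1)) linear0. Qed.
Fact syz_augK x : syz_p 0 (syz_diff 0 x) = 0.
Proof. exact: ses_comp (syz_ses 0) _. Qed.
Definition syz_resolution : augmented M :=
  @Augmented R M (@Complex R (fun n => 'rV[R]_(syz_n n)) syz_diff syz_diffK)
    (syz_p 0) syz_augK.

Lemma syz_diff0 n x : syz_p n x = 0 -> exists y, syz_diff n y = x.
Proof.
case: (syz_ses n) => _ _ ker /ker [z <-].
case: (syz_ses n.+1) => _ psurj _; have [y <-] := psurj z.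
by exists y.
Qed.

Lemma syz_resolutionP : projective_resolution syz_resolution.
Proof.
split=> [|n]; last exact: rV_projective.
apply/exact_complexP; case=> [|[|n]] x.
- by move=> _; case: (syz_ses 0) => _ psurj _; apply: psurj.
- by move=> /eqP /(syz_diff0 (n := 0)).
- move=> /eqP x0; apply: syz_diff0.
  case: (syz_ses n) => iinj _ _; apply: iinj.
  by rewrite linear0; apply: x0.
Qed.

(** This reduces Ext in degree n+1 to extending maps from the syzygy along its inclusion into a free
    module. *)
Lemma syz_cocycle (N : lmodType R) n (f : Defs.Hom (syz_resolution n.+1) N) :
  is_cocycle f ->
  exists g : {linear syz n.+1 -> N}, forall x, g (syz_p n.+1 x) = (f : {linear _ -> _}) x.
Proof.
move=> fZ; apply: (ses_factor (syz_ses n.+1)) => z.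
case: (syz_ses n.+2) => _ psurj _; have [y <-] := psurj z.
exact: fZ.
Qed.

End FreeSyzygies.

(** * Finitely generated modules with vanishing Ext into R *)

Section Perp.
Variable R : comNzRingType.
Implicit Types (M X Y K P : lmodType R).

(* Ext^1(M, R) = 0, expressed through extensions instead of resolutions. *)
Definition extends M : Prop :=
  forall X Y (i : {linear X -> Y}) (p : {linear Y -> M}), ses i p ->
  forall f : {linear X -> R^o}, exists g : {linear Y -> R^o}, forall x, g (i x) = f x.

(** One projective cover decides for all extensions. Lift [q] to a : P -> Y, restrict it to b : K ->
    X, and extend f b to c on P; then f on X and c on P agree where they must and define a form on Y
    = i X + a P. *)
Lemma extends_cover M K P (j : {linear K -> P}) (q : {linear P -> M}) :
  ses j q -> projective P ->
  (forall f : {linear K -> R^o}, exists g : {linear P -> R^o}, forall x, g (j x) = f x) ->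
  extends M.
Proof.
move=> [jinj qsurj jker] Pproj Kext X Y i p [iinj psurj iker] f.
have pi0 x : p (i x) = 0 by apply/iker; exists x.
have [a aE] := projective_lift q Pproj psurj.
have jq k : q (j k) = 0 by apply/jker; exists k.
have [k|b bE] := ses_lift (f := [the {linear K -> Y} of a \o j])
  (And3 iinj psurj iker); first by rewrite /= aE.
have [c cE] := Kext [the {linear K -> R^o} of f \o b].
have [y|e y r y' r'|r|g gE] := @lin_of_rel R Y R^o
   (fun y r => exists x z, y = i x + a z /\ r = f x + c z).
- have [z zE] := qsurj (p y).
  have /iker [x xE] : p (y - a z) = 0 by rewrite linearB aE zE subrr.
  by exists (f x + c z), x, z; rewrite xE subrK.
- move=> [x [z [-> ->]]] [x' [z' [-> ->]]]; exists (e *: x + x'), (e *: z + z').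
  by rewrite !linearP !scalerDr; split; rewrite addrACA.
- case=> x [z [/esym/eqP xz0 ->]].
  have /jker [k kE] : q z = 0.
    have := congr1 p (eqP xz0); rewrite linearD linear0 aE => <-.
    by rewrite pi0 add0r.
  have -> : x = - b k.
    apply: iinj; rewrite linearN bE /= kE; apply/eqP.
    by rewrite -addr_eq0.
  by rewrite linearN -kE cE /= addNr.
exists g => x; have [x' [z [xE ->]]] := gE (i x).
have /jker [k kE] : q z = 0.
  have := congr1 p xE; rewrite linearD aE.
  by rewrite !pi0 add0r.
rewrite -kE cE /= -linearD; congr (f _); apply: iinj.
by rewrite linearD bE /= kE -xE.
Qed.

Definition perp M : Prop :=
  fin_gen M /\ forall i : nat, i <> 0%N -> Ext_zero i M R^o.

Definition any_cover M n (p : {linear 'rV[R]_n -> M}) : Prop := True.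

Hypothesis Rn : noetherian R.

Lemma fin_gen_cover M : fin_gen M -> inhabited (free_cover (@fin_gen R) any_cover M).
Proof.
move=> /fin_genP [n [p psurj]]; constructor.
apply: (@FreeCover _ _ _ _ n _ _ p (ses_ker psurj)) => //.
apply: (fin_gen_sub Rn (@submod_incl_inj _ _ _)).
exact: fin_gen_rV.
Qed.

Lemma perp_extends M : perp M -> extends M.
Proof.
move=> [Mfg Mext].
have e0 := syz_ses fin_gen_cover Mfg 0.
apply: (extends_cover e0 (@rV_projective R _)) => f.
have n1 : 1%N <> 0%N by [].
have [|g gE] := Mext 1%N n1 (syz_resolution fin_gen_cover Mfg)
  (syz_resolutionP fin_gen_cover Mfg)
  ([the {linear _ -> R^o} of f \o syz_p fin_gen_cover Mfg 1] :
     Defs.Hom (syz_resolution fin_gen_cover Mfg 1%N) R^o).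
  by move=> x; rewrite /= (ses_comp (syz_ses fin_gen_cover Mfg 1)) linear0.
exists g => x; case: (syz_ses fin_gen_cover Mfg 1) => _ psurj _.
by have [y <-] := psurj x; apply: esym (gE y).
Qed.

(** Splicing a resolution of K onto P resolves M, so a cocycle of K in degree i+1 is one of M in
    degree i+2. *)
Lemma perp_kernel M K P (j : {linear K -> P}) (q : {linear P -> M}) :
  ses j q -> projective P -> fin_gen P -> perp M -> perp K.
Proof.
move=> e Pproj Pfg [Mfg Mext]; split.
  by case: e => jinj _ _; apply: fin_gen_sub jinj Pfg.
case=> // i _ A [Ares Aproj] f fZ.
have i2 : i.+2 <> 0%N by [].
have [] // := Mext i.+2 i2 (splice e A) _ f fZ.
  split; first exact: splice_resolution.
  by case=> [|n]; [apply: Pproj | apply: Aproj].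
by move=> g gE; exists g.
Qed.

(* Dimension shifting: Ext^1 vanishes on all syzygies of M, and a resolution of
   M can be built from covers that stay inside the class C. *)
Lemma perp_coind (C : lmodType R -> Prop) :
  (forall M, C M -> extends M) ->
  (forall M, C M -> inhabited (free_cover C any_cover M)) ->
  forall M, C M -> perp M.
Proof.
move=> Cext Ccov M CM; split.
  by have [c] := Ccov M CM; apply/fin_genP; case: (fc_ses c) => _ ps _; exists (fc_n c), (fc_p c).
case=> // i _; apply: (Ext_zero_resolution (syz_resolutionP Ccov CM)) => f fZ.
have [g gE] := syz_cocycle fZ.
have [h hE] := Cext _ (syz_in Ccov CM i) _ _ _ _ (syz_ses Ccov CM i) g.
by exists h => x; rewrite -gE -hE.
Qed.

(** A free module covers itself with kernel R^0, so the class of free modules is closed under taking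
    such syzygies. *)
Lemma ses_iso P M (f : {linear P -> M}) : bijective f ->
  ses ([the {linear 'rV[R]_0 -> P} of \0]) f.
Proof.
move=> [g fK gK]; split.
- by move=> x y _; apply/rowP; case.
- by move=> y; exists (g y).
- move=> x; split=> [x0|[y <-]]; last by rewrite /= linear0.
  by exists 0; apply: (can_inj fK); rewrite x0 /= linear0.
Qed.

Lemma perp_free M n : lmod_iso 'rV[R]_n M -> perp M.
Proof.
move=> h; apply: (@perp_coind (fun M => exists n, lmod_iso 'rV[R]_n M)); last by exists n.
  move=> N [k [f fb]]; apply: (extends_cover (ses_iso fb) (@rV_projective R _)).
  move=> g; exists [the {linear 'rV[R]_k -> R^o} of \0] => x /=.
  by rewrite (_ : x = 0) ?linear0 //; apply/rowP; case.
move=> N [k [f fb]]; constructor.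
apply: (@FreeCover _ _ _ _ _ _ _ _ (ses_iso fb)) => //.
by exists 0%N, [the {linear 'rV[R]_0 -> 'rV[R]_0} of idfun]; exists id.
Qed.

(** The class of such extensions B is closed under syzygies by the horseshoe construction. For an
    extension Y of B by X, a form on X extends to the preimage of A in Y because A is in [perp], and
    from there to Y because C is. *)
Lemma perp_ext (A B C : lmodType R) (i : {linear A -> B}) (p : {linear B -> C}) :
  ses i p -> perp A -> perp C -> perp B.
Proof.
move=> e Ap Cp.
apply: (@perp_coind (fun B =>
   exists (A C : lmodType R) (i : {linear A -> B}) (p : {linear B -> C}),
   [/\ ses i p, perp A & perp C])); last by exists A, C, i, p.
  move=> {A B C i p e Ap Cp} B [A [C [i [p [e Ap Cp]]]]] X Y j q [jinj qsurj jker] f.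
  have [iinj psurj iker] := e.
  pose pq : {linear Y -> C} := [the {linear Y -> C} of p \o q].
  have pqsurj : surj pq.
    by move=> c; have [b <-] := psurj c; have [y <-] := qsurj b; exists y.
  have e2 := ses_ker pqsurj.
  have [y|q' q'E] := ses_lift e
      (f := [the {linear submod (kerp pq) -> B} of q \o submod_incl (kerp pq)]).
    exact/eqP/(valP y).
  have [x|j' j'E] := ses_lift (f := j) e2.
    by rewrite /= (_ : q (j x) = 0) ?linear0 //; apply/jker; exists x.
  have e1 : ses j' q'.
    split.
    - by move=> x x' h; apply: jinj; rewrite -!j'E h.
    - move=> a; have [y yE] := qsurj (i a).
      have yk : y \in kerp pq by rewrite in_kerp /= yE (ses_comp e).
      by exists (SubMod yk); apply: iinj; rewrite q'E.
    - move=> y; split=> [y0|[x <-]].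
        have /jker [x xE] : q (val y) = 0 by rewrite -[LHS]q'E y0 linear0.
        by exists x; apply: val_inj; rewrite [LHS]j'E.
      apply: iinj; rewrite q'E /= [val _]j'E linear0.
      by apply/jker; exists x.
  have [g gE] := perp_extends Ap e1 f.
  have [h hE] := perp_extends Cp e2 g.
  by exists h => x; rewrite -gE -hE j'E.
move=> {A B C i p e Ap Cp} B [A [C [i [p [e Ap Cp]]]]].
have [iinj psurj iker] := e.
have [/fin_genP [a [f fsurj]] _] := Ap.
have [/fin_genP [c [g gsurj]] _] := Cp.
have [h hE] := projective_lift g (@rV_projective R c) psurj.
have [k kE] : exists k : {linear 'rV[R]_(a + c) -> B},
    forall x : 'rV_(a + c), k x = i (f (lsubmx x)) + h (rsubmx x).
  by apply: linear_ex => r x y; rewrite !linearP scalerDr addrACA.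
have ksurj : surj k.
  move=> x; have [y yE] := gsurj (p x).
  have /iker [u uE] : p (x - h y) = 0 by rewrite linearB hE yE subrr.
  have [z zE] := fsurj u; exists (row_mx z y).
  by rewrite kE row_mxKl row_mxKr zE uE subrK.
constructor; apply: (@FreeCover _ _ _ _ _ _ _ _ (ses_ker ksurj)) => //.
have ef := ses_ker fsurj; have eg := ses_ker gsurj.
have [x0 xE0] : exists l : {linear submod (kerp f) -> 'rV[R]_(a + c)},
    forall x, l x = row_mx (val x) 0.
  apply: linear_ex => r x y; rewrite scale_row_mx add_row_mx scaler0 addr0.
  by congr row_mx; apply: (linearP (submod_incl (kerp f))).
have [y0 yE0] : exists l : {linear submod (kerp k) -> 'rV[R]_c},
    forall x, l x = rsubmx (val x).
  by apply: linear_ex => r x y; rewrite -linearP; congr rsubmx.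
have kP (x : submod (kerp k)) : i (f (lsubmx (val x))) + h (rsubmx (val x)) = 0.
  by rewrite -kE; apply/eqP/(valP x).
have [x|j jE] := ses_lift (f := x0) (ses_ker ksurj).
  have /eqP fx : f (val x) == 0 := valP x.
  by rewrite kE xE0 row_mxKl row_mxKr fx !linear0 addr0.
have [x|q qE] := ses_lift (f := y0) eg.
  rewrite yE0; have := congr1 p (kP x).
  by rewrite linearD hE (ses_comp e) add0r linear0.
exists (submod (kerp f)), (submod (kerp g)), j, q; split.
- split.
  + move=> x y jxy; apply: val_inj.
    have : x0 x = x0 y by rewrite -!jE jxy.
    by rewrite !xE0 => /eq_row_mx [].
  + move=> y; have /iker [u uE] : p (h (val y)) = 0.
      by rewrite hE; apply/eqP/(valP y).
    have [z zE] := fsurj u.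
    have xk : row_mx (- z) (val y) \in kerp k.
      by rewrite in_kerp kE row_mxKl row_mxKr linearN zE linearN uE addNr.
    by exists (SubMod xk); apply: val_inj; rewrite [LHS]qE yE0 row_mxKr.
  + move=> x; split=> [qx|[y <-]].
      have rx : rsubmx (val x) = 0 by rewrite -yE0 -qE qx linear0.
      have lx : lsubmx (val x) \in kerp f.
        rewrite in_kerp; apply/eqP/iinj; rewrite linear0 -[RHS](kP x) rx.
        by rewrite linear0 addr0.
      exists (SubMod lx); apply: val_inj; rewrite [LHS]jE xE0 /=.
      by rewrite -[RHS]hsubmxK rx.
    apply: val_inj; rewrite [LHS]qE yE0 [val _]jE xE0 row_mxKr.
    exact/esym/(linear0 (submod_incl (kerp g))).
- exact: perp_kernel ef (@rV_projective R a) (fin_gen_rV R a) Ap.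
- exact: perp_kernel eg (@rV_projective R c) (fin_gen_rV R c) Cp.
Qed.

End Perp.

(** * Totally reflexive modules *)

Section Duals.
Variable R : comNzRingType.
Implicit Types A B C G M V : lmodType R.

Lemma reflexiveP V : bijective (@biduality R V) <->
  (forall x : V, (forall f : {linear V -> R^o}, f x = 0) -> x = 0) /\
  (forall phi : {linear dual V -> R^o}, exists x : V,
     forall f : {linear V -> R^o}, phi f = f x).
Proof.
split=> [[g fK gK]|[inj srj]].
  split=> [x x0|phi].
    apply: (can_inj fK); apply: Hom_ext => f /=.
    by rewrite linear0; apply: x0.
  by exists (g phi) => f; rewrite -[in LHS](gK phi).
have [g gE] := choice (fun phi : dual (dual V) => srj phi).
have gK : cancel g (@biduality R V).
  by move=> phi; apply: Hom_ext => f /=; rewrite gE.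
exists g => // x; apply/eqP; rewrite -subr_eq0; apply/eqP/inj => f.
by rewrite linearB -gE /= subrr.
Qed.

Lemma dual_map_ex A B (i : {linear A -> B}) :
  exists j : {linear dual B -> dual A},
    forall (f : {linear B -> R^o}) x, (j f : {linear A -> R^o}) x = f (i x).
Proof.
have [a f g|j jE] := @linear_ex R (dual B) (dual A)
    (fun f => [the {linear A -> R^o} of (f : {linear B -> R^o}) \o i]).
  by apply: Hom_ext.
by exists j => f x; rewrite jE.
Qed.

Lemma ses_dual A B C (i : {linear A -> B}) (p : {linear B -> C}) :
  ses i p -> extends C ->
  exists (p' : {linear dual C -> dual B}) (i' : {linear dual B -> dual A}),
   [/\ ses p' i',
       forall (f : {linear C -> R^o}) x, (p' f : {linear B -> R^o}) x = f (p x) &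
       forall (f : {linear B -> R^o}) x, (i' f : {linear A -> R^o}) x = f (i x)].
Proof.
move=> e Cext; have [p' p'E] := dual_map_ex p; have [i' i'E] := dual_map_ex i.
exists p', i'; split=> //; split.
- move=> f g fg; apply: Hom_ext => c; case: e => _ psurj _.
  by have [b <-] := psurj c; rewrite -!p'E fg.
- move=> f; have [g gE] := Cext _ _ _ _ e f.
  by exists g; apply: Hom_ext => x; rewrite i'E.
- move=> f; split=> [f0|[g <-]].
    have [x|g gE] := ses_factor (f := f) e; first by rewrite -i'E f0.
    by exists g; apply: Hom_ext => x; rewrite p'E.
  by apply: Hom_ext => x; rewrite i'E p'E (ses_comp e) linear0.
Qed.

Hypothesis Rn : noetherian R.

(** What has to be supplied is that the dual of G is finitely generated: dualizing a free cover of G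
    embeds it into R^n. *)
Lemma totally_reflexiveP G : totally_reflexive G <->
  [/\ perp G, perp (dual G) & bijective (@biduality R G)].
Proof.
split=> [[Gfg Gbij GE GE']|[[Gfg GE] [_ GE'] Gbij]] //; split=> //; split=> //.
have [n [p psurj]] := (fin_genP G).1 Gfg.
have [j jE] := dual_map_ex p.
have [l lE] : exists l : {linear dual 'rV[R]_n -> 'rV[R]_n},
    forall f : {linear 'rV[R]_n -> R^o}, l f = \row_i f (delta_mx 0 i).
  by apply: linear_ex => a f g; apply/rowP => i; rewrite !mxE.
apply: (@fin_gen_sub R Rn _ 'rV[R]_n [the {linear _ -> _} of l \o j]); last first.
  exact: fin_gen_rV.
apply: linear_inj => f /= lj0; apply: Hom_ext => x.
have [v <-] := psurj x; rewrite [RHS]/= -(jE f) rV_lin_sum big1 // => i _.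
have /rowP/(_ i) := lj0; rewrite lE !mxE => ->.
exact: scaler0.
Qed.

(** Both B and its dual are extensions of [perp] modules. Biduality is a five lemma chase: a form on
    the dual of B is corrected by evaluation at a point of B until it comes from the dual of A. *)
Lemma totally_reflexive_ext A B C (i : {linear A -> B}) (p : {linear B -> C}) :
  ses i p -> totally_reflexive A -> totally_reflexive C -> totally_reflexive B.
Proof.
move=> e /totally_reflexiveP [Ap Ad /reflexiveP [Ainj Asurj]].
move=> /totally_reflexiveP [Cp Cd /reflexiveP [Cinj Csurj]].
have Cext := perp_extends Rn Cp.
have [p' [i' [e' p'E i'E]]] := ses_dual e Cext.
apply/totally_reflexiveP; split.
- exact: perp_ext e Ap Cp.
- exact: perp_ext e' Cd Ad.
apply/reflexiveP; split=> [x x0|phi].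
  have px0 : p x = 0 by apply: Cinj => f; rewrite -p'E.
  case: (e) => _ _ ker; have /ker [y yE] := px0.
  rewrite -yE; rewrite (Ainj y) ?linear0 // => f.
  by have [g gE] := Cext _ _ _ _ e f; rewrite -gE yE.
have [z zE] := Csurj [the {linear dual C -> R^o} of phi \o p'].
case: (e) => _ psurj _; have [x0 x0E] := psurj z.
have [h|psi psiE] := ses_factor e' (f := [the {linear dual B -> R^o} of
    phi \- (@biduality R B x0 : {linear dual B -> R^o})]).
  by rewrite /= p'E x0E -zE subrr.
have [y yE] := Asurj psi; exists (x0 + i y) => f.
have := psiE f; rewrite yE i'E /= => fiy.
by rewrite linearD fiy addrC subrK.
Qed.

Lemma totally_reflexive_free n M : lmod_iso 'rV[R]_n M -> totally_reflexive M.
Proof.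
move=> h; apply/totally_reflexiveP.
have [f [g fK gK]] := h.
(* These coordinate forms are the basis of the dual that is dual to the transported standard
   basis. *)
have rcoord (j : 'I_n) : exists c : {linear M -> R^o}, forall x, c (f x) = x 0 j.
  have [||r|c cE] := @lin_of_rel R M R^o (fun y r => exists2 x, f x = y & r = x 0 j).
  - by move=> y; exists (g y 0 j), (g y).
  - move=> a x y x' y' [z <- ->] [z' <- ->].
    by exists (a *: z + z'); rewrite ?linearP // !mxE.
  - by case=> x x0 ->; rewrite (_ : x = 0) ?mxE //; apply: (can_inj fK); rewrite x0 linear0.
  by exists c => x; have [z /(can_inj fK) -> ->] := cE (f x).
have [c cE] := choice rcoord.
have cD (x : M) : x = \sum_j (c j x) *: f (delta_mx 0 j).
  by rewrite -[x in LHS]gK rV_lin_sum; apply: eq_bigr => j _; rewrite -cE gK.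
have [d dE] := rV_lin_ex (fun j => c j : dual M).
have ev (x : M) (v : 'I_n -> R) :
    ((\sum_j v j *: (c j : dual M) : dual M) : {linear M -> R^o}) x =
    \sum_j v j * c j x.
  have [e eE] : exists e : {linear dual M -> R^o}, forall u : {linear M -> R^o}, e u = u x.
    by apply: linear_ex.
  by rewrite -eE linear_sum; apply: eq_bigr => j _; rewrite linearZ eE.
have dD (u : {linear M -> R^o}) : (u : dual M) = \sum_j u (f (delta_mx 0 j)) *: (c j : dual M).
  apply: Hom_ext => x; rewrite ev {1}[x]cD linear_sum; apply: eq_bigr => j _.
  by rewrite linearZ /= mulrC.
split.
- exact: perp_free h.
- apply: (perp_free (n := n)); apply/lmod_isoP; exists d; split.
    apply: linear_inj => v v0; apply/rowP => j; rewrite mxE.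
    have := congr1 (fun u : dual M => (u : {linear M -> R^o}) (f (delta_mx 0 j))) v0.
    rewrite dE ev (bigD1 j) //= big1 ?addr0 => [|k kj]; rewrite cE mxE eqxx.
      by rewrite eqxx mulr1.
    by rewrite (negPf kj) mulr0.
  move=> u; exists (\row_j (u : {linear M -> R^o}) (f (delta_mx 0 j))).
  by rewrite dE [RHS]dD; apply: eq_bigr => j _; rewrite mxE.
apply/reflexiveP; split=> [x x0|phi].
  by rewrite [x]cD big1 // => j _; rewrite x0 scale0r.
exists (\sum_j phi (c j) *: f (delta_mx 0 j)) => u.
transitivity (phi (\sum_j u (f (delta_mx 0 j)) *: (c j : dual M))).
  by congr (phi _); apply: dD.
rewrite linear_sum [RHS]linear_sum; apply: eq_bigr => j _.
by rewrite linearZ [RHS]linearZ; apply: mulrC.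
Qed.

Lemma totally_reflexive_zero M : zero_module M -> totally_reflexive M.
Proof.
move=> M0; apply: (@totally_reflexive_free 0).
exists [the {linear 'rV[R]_0 -> M} of \0]; exists (fun=> 0) => x.
  by apply/rowP; case.
by rewrite [LHS]M0 [RHS]M0.
Qed.

(* C is the cokernel of the dual of a free cover q of G^*, so that C^* is the
   kernel of q. *)
Lemma cosyzygy_ex G : totally_reflexive G ->
  exists a (C : lmodType R) (i : {linear G -> 'rV[R]_a}) (p : {linear 'rV[R]_a -> C}),
    ses i p /\ totally_reflexive C.
Proof.
move=> /totally_reflexiveP [Gp Gd /reflexiveP [Ginj Gsurj]].
have /fin_genP [a [q qsurj]] := Gd.1.
pose Q (v : 'rV[R]_a) : {linear G -> R^o} := q v.
pose dot (v w : 'rV[R]_a) : R := \sum_j v 0 j * w 0 j.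
have dotC v w : dot v w = dot w v.
  by apply: eq_bigr => j _; rewrite mulrC.
have dotl w : exists d : {linear 'rV[R]_a -> R^o}, forall v, d v = dot v w.
  apply: linear_ex => r x y; rewrite /dot scaler_sumr -big_split.
  by apply: eq_bigr => j _; rewrite !mxE mulrDl -mulrA.
have dotE (d : {linear 'rV[R]_a -> R^o}) v : d v = dot v (\row_j d (delta_mx 0 j)).
  by rewrite rV_lin_sum; apply: eq_bigr => j _; rewrite mxE.
(* Under the pairing [dot], [i] is biduality followed by the dual of [q]. It is injective because
   [q] is onto and the forms on G separate its points. *)
have [i iE] : exists i : {linear G -> 'rV[R]_a}, forall x, i x = \row_j Q (delta_mx 0 j) x.
  by apply: linear_ex => r x y; apply/rowP => j; rewrite !mxE linearP.
have QE v x : Q v x = dot v (i x).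
  have [d dE] : exists d : {linear 'rV[R]_a -> R^o}, forall v, d v = Q v x.
    by apply: linear_ex => r y z; rewrite /Q linearP.
  by rewrite -dE dotE; apply: eq_bigr => j _; rewrite iE !mxE dE.
have iinj : injective i.
  apply: linear_inj => x x0; apply: Ginj => f; have [v vE] := qsurj f.
  have := QE v x; rewrite /Q vE x0 => ->.
  by rewrite /dot big1 // => j _; rewrite mxE mulr0.
have [C [p e]] := ses_coker iinj.
have [_ psurj ker] := e.
have [k kE] : exists k : {linear dual C -> 'rV[R]_a},
   forall f : {linear C -> R^o}, k f = \row_j f (p (delta_mx 0 j)).
  by apply: linear_ex => r f g; apply/rowP => j; rewrite !mxE.
have kd (f : {linear C -> R^o}) w : dot (k f) w = f (p w).
  rewrite dotC -[RHS]/([the {linear _ -> R^o} of f \o p] w) dotE kE.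
  by apply: eq_bigr => j _; rewrite !mxE.
have e' : ses k q.
  split=> // [f g fg|v].
    apply: Hom_ext => c; have [w <-] := psurj c.
    by rewrite -!kd fg.
  split=> [q0|[f <-]]; last first.
    apply: Hom_ext => x; rewrite -[LHS]/(Q (k f) x) QE kd (ses_comp e) linear0.
    by [].
  have [d dE] := dotl v.
  have [x|f fE] := ses_factor (f := d) e.
    by rewrite dE dotC -QE /Q q0.
  exists f; apply/rowP => j; rewrite kE mxE fE dE /dot (bigD1 j) //= mxE !eqxx mul1r.
  by rewrite big1 ?addr0 // => l lj; rewrite mxE (negPf lj) mul0r.
exists a, C, i, p; split=> //; apply/totally_reflexiveP; split.
(* The class is closed under syzygies, since the syzygy of C is G. Forms on G extend along [i]
   because [q] is onto the dual of G. *)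
- apply: (@perp_coind R (fun Z => perp Z \/ exists p' : {linear 'rV[R]_a -> Z}, ses i p')).
  + move=> Z [Zp|[p' e2]]; first exact: perp_extends Zp.
    apply: (extends_cover e2 (@rV_projective R a)) => f.
    have [v vE] := qsurj f; have [d dE] := dotl v; exists d => x.
    by rewrite dE dotC -QE /Q vE.
  + move=> Z [Zp|[p' e2]]; last first.
      by constructor; apply: (@FreeCover _ _ _ _ _ _ _ _ e2) => //; left.
    have /fin_genP [n [f fsurj]] := Zp.1.
    constructor; apply: (@FreeCover _ _ _ _ _ _ _ _ (ses_ker fsurj)) => //; left.
    apply: (perp_kernel Rn (ses_ker fsurj) (@rV_projective R n)) => //.
    exact: fin_gen_rV.
  + by right; exists p.
- apply: (perp_kernel Rn e' (@rV_projective R a)) => //.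
  exact: fin_gen_rV.
(* If every form on C kills [p w], then pairing with w vanishes on the kernel of [q]. It descends to
   a form on the dual of G, that is, to evaluation at some x, and w = i x. *)
apply/reflexiveP; split=> [y y0|phi].
  have [w wE] := psurj y; have [d dE] := dotl w.
  have [f|psi psiE] := ses_factor (f := d) e'; first by rewrite dE kd wE.
  have [x xE] := Gsurj psi; rewrite -wE; apply/ker; exists x.
  apply/rowP => j; rewrite iE mxE -xE psiE dE /dot (bigD1 j) //= mxE !eqxx mul1r.
  by rewrite big1 ?addr0 // => l lj; rewrite mxE (negPf lj) mul0r.
(* The dual of C sits in R^a with quotient the dual of G, so [phi] extends to R^a, where it is
   pairing with a vector. *)
have [g gE] := perp_extends Rn Gd e' phi.
exists (p (\row_j g (delta_mx 0 j))) => f.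
by rewrite -gE dotE kd.
Qed.

End Duals.

(** * Auslander-Buchweitz approximation *)

Section Approximation.
Variable R : comNzRingType.
Implicit Types K G M : lmodType R.

(* M has a free resolution 0 -> R^(s_k) -> ... -> R^(s_0) -> M -> 0. *)
Fixpoint free_res (s : seq nat) (M : lmodType R) : Prop :=
  match s with
  | [::] => zero_module M
  | a :: s' => exists (K : lmodType R) (i : {linear K -> 'rV[R]_a})
                 (p : {linear 'rV[R]_a -> M}),
                 ses i p /\ free_res s' K
  end.

Hypothesis Rn : noetherian R.

(* E = (G0 + R^a) / G' and K = R^a / K': the module E is an extension of C by G0,
   and G0 / M' = M becomes E / K. *)
Lemma pushout_approx (M' G0 M K' G' C : lmodType R) a
    (j : {linear M' -> G0}) (e0 : {linear G0 -> M})
    (k : {linear K' -> G'}) (q : {linear G' -> M'})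
    (l : {linear G' -> 'rV[R]_a}) (r : {linear 'rV[R]_a -> C}) :
  ses j e0 -> ses k q -> ses l r -> totally_reflexive G0 -> totally_reflexive C ->
  exists (K E : lmodType R) (i : {linear K -> E}) (p : {linear E -> M})
    (l' : {linear K' -> 'rV[R]_a}) (r' : {linear 'rV[R]_a -> K}),
    [/\ ses i p, totally_reflexive E & ses l' r'].
Proof.
move=> ej ek el G0t Ct.
have [jinj e0surj jker] := ej; have [kinj qsurj kker] := ek.
have [linj rsurj lker] := el.
pose P : lmodType R := (G0 * 'rV[R]_a)%type.
have [u uE] : exists u : {linear G' -> P}, forall g, u g = (j (q g), - l g).
  by apply: linear_ex => c x y; rewrite !linearP.
have [E [v ev]] : exists (E : lmodType R) (v : {linear P -> E}), ses u v.
  apply: ses_coker; apply: linear_inj => x; rewrite uE => -[_ /eqP].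
  by rewrite oppr_eq0 => /eqP lx; apply: linj; rewrite lx linear0.
have [K [r' er]] : exists (K : lmodType R) (r' : {linear 'rV[R]_a -> K}),
    ses ([the {linear K' -> 'rV[R]_a} of l \o k]) r'.
  by apply: ses_coker => x y /= /linj /kinj.
have [uinj vsurj vker] := ev; have [_ r'surj r'ker] := er.
have [inl inlE] : exists f : {linear G0 -> P}, forall x, f x = (x, 0).
  by apply: linear_ex => c x y; congr pair; rewrite /= scaler0 addr0.
have [inr inrE] : exists f : {linear 'rV[R]_a -> P}, forall x, f x = (0, x).
  by apply: linear_ex => c x y; congr pair; rewrite /= scaler0 addr0.
have [x|i iE] := ses_factor (f := [the {linear 'rV[R]_a -> E} of v \o inr]) er.
  apply/vker; exists (- k x); rewrite linearN uE /= inrE.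
  by rewrite (ses_comp ek) linear0; congr pair; rewrite ?oppr0 ?opprK.
have [x|p pE] := ses_factor (f := [the {linear P -> M} of e0 \o fst]) ev.
  by rewrite /= uE /= (ses_comp ej).
have [x|t tE] := ses_factor (f := [the {linear P -> C} of r \o snd]) ev.
  by rewrite /= uE /= linearN (ses_comp el) oppr0.
exists K, E, i, p, [the {linear K' -> 'rV[R]_a} of l \o k], r'; split=> //.
- split.
  + apply: linear_inj => y; have [x <-] := r'surj y; rewrite iE /=.
    move=> /vker [g]; rewrite uE inrE => -[jqg lg].
    have /kker [x' x'E] : q g = 0 by apply: jinj; rewrite jqg linear0.
    by apply/r'ker; exists (- x'); rewrite /= !linearN x'E.
  + move=> y; have [x <-] := e0surj y; exists (v (x, 0)).
    by rewrite pE.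
  + move=> y; have [[x w] <-] := vsurj y; rewrite pE /=; split.
      move=> /jker [m mE]; have [g gE] := qsurj m.
      exists (r' (w + l g)); rewrite iE /=.
      apply/eqP; rewrite eq_sym -subr_eq0 -linearB; apply/eqP/vker; exists g.
      by rewrite uE inrE gE mE; congr pair; rewrite /= ?subr0 // opprD addrA subrr add0r.
    case=> z; have [w' <-] := r'surj z; rewrite iE /= inrE => /eqP.
    rewrite -subr_eq0 -linearB => /eqP /vker [g]; rewrite uE => -[h _].
    apply/jker; exists (- q g); rewrite linearN h.
    by rewrite /= opprB subr0.
- have eE : ses ([the {linear G0 -> E} of v \o inl]) t.
    split.
    + apply: linear_inj => x /= /vker [g]; rewrite uE inlE => -[<- /eqP].
      rewrite oppr_eq0 => /eqP lg; rewrite (_ : g = 0) ?linear0 //.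
      by apply: linj; rewrite lg linear0.
    + by move=> c; have [w <-] := rsurj c; exists (v (0, w)); rewrite tE.
    + move=> y; have [[x w] <-] := vsurj y; rewrite tE /=; split.
        move=> /lker [g gE]; exists (x + j (q g)); rewrite inlE.
        apply/eqP; rewrite -subr_eq0 -linearB; apply/eqP/vker; exists g.
        rewrite uE gE; congr pair; rewrite /= ?sub0r //.
        by rewrite addrC addKr.
      case=> z; rewrite /= inlE => /eqP; rewrite -subr_eq0 -linearB => /eqP /vker [g].
      rewrite uE => -[_ h]; apply/lker; exists g.
      by apply: oppr_inj; rewrite h sub0r.
  exact: totally_reflexive_ext eE G0t Ct.
Qed.

(** Induction on the length of a G-resolution. The kernel of the augmentation is approximated by
    some G', which embeds into a free module with totally reflexive cokernel; the pushout turns this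
    into an approximation of M, with one more free term in the resolution of K. *)
Lemma approximation M : finite_Gdim M ->
  exists (K G : lmodType R) (i : {linear K -> G}) (p : {linear G -> M}) s,
    [/\ ses i p, totally_reflexive G & free_res s K].
Proof.
case=> A [[Ares Atr] [n An]].
(* Counting terms instead of the top degree lets the induction start at M = 0. *)
have {An} An i : (n.+1 <= i)%N -> zero_module (A i) by apply: An.
elim: n.+1 M A Ares Atr An => {n} [|n IHn] M A Ares Atr An.
  have M0 : zero_module M.
    move=> x; have /exact_complexP/(_ 0%N x isT) [y <-] := Ares.
    by rewrite (An 0%N isT y) linear0.
  exists 'rV[R]_0, M, [the {linear 'rV[R]_0 -> M} of \0], [the {linear M -> M} of idfun], [::].
  split; last by move=> x; apply/rowP; case.
    split.
    - by move=> x y _; apply/rowP; case.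
    - by move=> y; exists y.
    - by move=> x; split=> _; [exists 0; rewrite linear0 [RHS]M0 | apply: M0].
  exact: totally_reflexive_zero.
have [B [Bres BA]] := tail_ex Ares.
have [||K' [G' [k [q [s [ek G't K's]]]]]] := IHn _ B Bres.
- by move=> i; rewrite BA.
- by move=> i ni; rewrite BA; apply: An.
have [a [C [l [r [el Ct]]]]] := cosyzygy_ex Rn G't.
have psurj : surj (aug_map A) by move=> y; have /exact_complexP/(_ 0%N y isT) := Ares.
have [K [E [i [p [l' [r' [ei Et er]]]]]]] := pushout_approx (ses_ker psurj) ek el (Atr 0%N) Ct.
by exists K, E, i, p, (a :: s); split=> //; exists K', l', r'.
Qed.

End Approximation.

(** * Proper resolutions and relative Betti numbers *)

Section ProperResolutions.
Variable R : comNzRingType.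
Implicit Types H K G M : lmodType R.

Lemma splice_lifts H K G M (i : {linear K -> G}) (p : {linear G -> M})
    (e : ses i p) (A : augmented K) :
  (forall h : {linear H -> M}, exists g : {linear H -> G}, forall x, p (g x) = h x) ->
  lifts H (plus_complex A) -> lifts H (plus_complex (splice e A)).
Proof.
move=> hG hA [|[|[|n]]] f fZ; first exact: hG.
- have [x|f' f'E] := ses_lift (f := f) e; first exact/eqP/fZ.
  have [//|g gE] := hA 0%N f'.
  by exists g => y; rewrite /= -f'E -gE.
- apply: (hA 1%N f) => y; apply/eqP; case: (e) => iinj _ _; apply: iinj.
  by rewrite linear0; apply/eqP/fZ.
- exact: (hA n.+2 f).
Qed.

Hypothesis Rn : noetherian R.

(** In effect Ext^1(H, K) = 0, by induction on the free resolution of K. Lift h to b on a free cover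
    of H and restrict b to u : H' -> K on the syzygy H'. By induction u lifts to the free module
    over K; that lift extends to the cover as Ext^1(H, R) = 0, and subtracting it from b gives a map
    that descends to H. *)
Lemma perp_lift s K H G M (i : {linear K -> G}) (p : {linear G -> M}) :
  ses i p -> free_res s K -> perp H ->
  forall h : {linear H -> M}, exists g : {linear H -> G}, forall x, p (g x) = h x.
Proof.
elim: s K H G M i p => [|a s IHs] K H G M i p e /=.
  move=> K0 _ h; have [_ psurj ker] := e.
  have [x|c x y x' y' xy x'y'|y|g gE] := @lin_of_rel R H G (fun x y => p y = h x).
  - exact: psurj.
  - by rewrite !linearP xy x'y'.
  - by rewrite linear0 => /ker [k <-]; rewrite (K0 k) linear0.
  - by exists g.
move=> [K' [i' [p' [e' K's]]]] Hp h.
have /fin_genP [n [c csurj]] := Hp.1.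
have ec := ses_ker csurj.
have H'p : perp (submod (kerp c)).
  apply: (perp_kernel Rn ec (@rV_projective R n)) => //.
  exact: fin_gen_rV.
have [_ psurj _] := e.
have [b bE] := projective_lift [the {linear 'rV[R]_n -> M} of h \o c] (@rV_projective R n) psurj.
have [x|u uE] := ses_lift e
    (f := [the {linear submod (kerp c) -> G} of b \o submod_incl (kerp c)]).
  by rewrite /= bE /= (ses_comp ec) linear0.
have [v vE] := IHs _ _ _ _ _ _ e' K's H'p u.
have vext j : exists w : {linear 'rV[R]_n -> R^o}, forall x, w (submod_incl (kerp c) x) = v x 0 j.
  have [d dE] : exists d : {linear submod (kerp c) -> R^o}, forall x, d x = v x 0 j.
    by apply: linear_ex => r x y; rewrite linearP !mxE.
  by have [w wE] := perp_extends Rn Hp ec d; exists w => x; rewrite wE dE.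
have [w0 w0E] := choice vext.
have [w wE] : exists w : {linear 'rV[R]_n -> 'rV[R]_a}, forall x, w x = \row_j w0 j x.
  by apply: linear_ex => r x y; apply/rowP => j; rewrite !mxE linearP.
have wv x : w (submod_incl (kerp c) x) = v x.
  by apply/rowP => j; rewrite wE mxE w0E.
have [x|g gE] := ses_factor (f := [the {linear 'rV[R]_n -> G} of b \- (i \o (p' \o w))]) ec.
  by rewrite /= [w _]wv vE uE subrr.
exists g => x; have [y <-] := csurj x.
by rewrite gE /= linearB bE (ses_comp e) subr0.
Qed.

(** The default 0 of [nth] puts R^0 beyond the end of [s]. The lifting clause is what makes the
    spliced resolution of M proper. *)
Lemma free_res_resolution s K : free_res s K ->
  exists A : augmented K, [/\ is_resolution A,
    forall n, A n = 'rV[R]_(nth 0%N s n) &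
    forall H, perp H -> lifts H (plus_complex A)].
Proof.
elim: s K => [|a s IHs] K /=.
  move=> K0; pose C := @Complex R (fun=> 'rV[R]_0)
    (fun n => [the {linear 'rV[R]_0 -> 'rV[R]_0} of \0])
    (fun n x => erefl).
  pose A : augmented K := @Augmented R K C [the {linear 'rV[R]_0 -> K} of \0] (fun x => erefl).
  have A0 n : zero_module (plus_complex A n).
    by case: n => [|n] x; [apply: K0 | apply/rowP; case].
  exists A; split=> [|n|H _ n f _].
  - by apply/exact_complexP => n x _; exists 0; rewrite (A0 n x) linear0.
  - by rewrite nth_nil.
  - by exists [the {linear H -> plus_complex A n.+1} of \0] => y; rewrite [RHS]A0 [LHS]A0.
case=> K' [i [p [e K's]]]; have [A [Ares An Alift]] := IHs _ K's.
exists (splice e A); split.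
- exact: splice_resolution.
- by case.
- by move=> H Hp; apply: splice_lifts; [apply: perp_lift e K's Hp | apply: Alift].
Qed.

End ProperResolutions.

(** * Homotopy invariance of homology and of tensored complexes *)

Section HomotopyInvariance.
Variable R : comNzRingType.
Implicit Types C D : complex R.

Lemma homotopic_cycle C (u : forall n, {linear C n -> C n}) h n x :
  chain_homotopy u h -> x \in @cycles R C n -> exists y, u n x = cdiff C n y.
Proof.
move=> [h0 hS]; case: n x => [|n] x; first by exists (h 0%N x); apply: h0.
by move=> /eqP x0; exists (h n.+1 x); rewrite hS x0 linear0 addr0.
Qed.

Lemma chain_map_cycle C D (f : forall n, {linear C n -> D n}) n x :
  chain_map f -> x \in @cycles R C n -> f n x \in @cycles R D n.
Proof.
move=> fC; case: n x => [|n] x // /eqP x0.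
by apply/eqP; rewrite fC x0 linear0.
Qed.

Lemma homotopy_equiv_homology C D : homotopy_equiv C D ->
  forall n, lmod_iso (homology C n) (homology D n).
Proof.
move=> [f [g [h [k [fC gC hE kE]]]]] n.
pose cl (E : complex R) (x : submod (@cycles R E n)) : homology E n :=
  quotmod_class (@boundary_cycles R E n) x.
have clL (E : complex R) a (x y : submod (@cycles R E n)) :
    cl E (a *: x + y) = a *: cl E x + cl E y by apply: quotmod_class_linear.
have valL (E : complex R) a (x y : submod (@cycles R E n)) :
    val (a *: x + y) = a *: val x + val y by apply: (linearP (submod_incl _)).
apply: (@iso_of_rel R (homology C n) (homology D n) (fun q r => exists x y,
   [/\ cl C x = q, cl D y = r & val y = f n (val x)])).
- elim/quotmodW => x; have fx := chain_map_cycle fC (valP x).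
  by exists (cl D (SubMod fx)), x, (SubMod fx).
- move=> a _ _ _ _ [x [y [<- <- xy]]] [x' [y' [<- <- xy']]].
  exists (a *: x + x'), (a *: y + y'); split; [exact: clL|exact: clL|].
  by rewrite !valL xy xy' linearP.
- move=> _ [x [y [/homology_class0 [z zE] <- xy]]]; apply/homology_class0.
  by exists (f n.+1 z); rewrite fC zE xy.
- elim/quotmodW => y; have gy := chain_map_cycle gC (valP y).
  have fgy := chain_map_cycle fC gy.
  exists (cl C (SubMod gy)), (SubMod gy), (SubMod fgy); split=> //.
  have [z zE] := homotopic_cycle kE (valP y).
  apply/eqP; rewrite -subr_eq0 -[X in _ - X]/(cl D y); apply/eqP.
  have -> : cl D (SubMod fgy) - cl D y = cl D (SubMod fgy - y).
    by rewrite addrC -scaleN1r -clL scaleN1r addrC.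
  apply/homology_class0; exists z; rewrite -zE.
  exact/esym/(linearB (submod_incl (@cycles R D n))).
- move=> _ [x [y [<- /homology_class0 [z zE] xy]]]; apply/homology_class0.
  have [w wE] := homotopic_cycle hE (valP x).
  exists (g n.+1 z - w); rewrite linearB -wE gC zE xy /=.
  by rewrite opprB addrC subrK.
Qed.

Lemma tensor_map_comp (U V W N : lmodType R) (f : {linear U -> V}) (g : {linear V -> W}) z :
  tensor_map N g (tensor_map N f z) =
  tensor_map N [the {linear U -> W} of g \o f] z.
Proof.
rewrite -[LHS]/([the {linear _ -> _} of tensor_map N g \o tensor_map N f] z).
by apply: tensor_ext => x y /=; rewrite !tensor_mapE.
Qed.

Lemma tensor_map_eq (U V N : lmodType R) (f g : {linear U -> V}) :
  f =1 g -> tensor_map N f =1 tensor_map N g.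
Proof. by move=> fg; apply: tensor_ext => x y; rewrite !tensor_mapE fg. Qed.

Lemma tensor_mapD (U V N : lmodType R) (f g h : {linear U -> V}) z :
  (forall x, h x = f x + g x) -> tensor_map N h z = tensor_map N f z + tensor_map N g z.
Proof.
move=> hE; rewrite -[RHS]/([the {linear _ -> _} of tensor_map N f \+ tensor_map N g] z).
by apply: tensor_ext => x y /=; rewrite !tensor_mapE hE linearDl.
Qed.

Lemma tensor_mapB1 (U N : lmodType R) (f h : {linear U -> U}) z :
  (forall x, h x = f x - x) -> tensor_map N h z = tensor_map N f z - z.
Proof.
move=> hE; rewrite -[RHS]/([the {linear _ -> _} of tensor_map N f \- idfun] z).
by apply: tensor_ext => x y /=; rewrite !tensor_mapE hE linearBl.
Qed.

(** Here [u] stands for g f - 1 before tensoring and [w] for the corresponding difference after it.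
    They are separate arguments because tensoring commutes with differences only pointwise. *)
Lemma tensor_homotopy C (N : lmodType R) (u v : forall n, {linear C n -> C n})
    (w : forall n, {linear tensor (C n) N -> tensor (C n) N}) h :
  (forall n x, u n x = v n x - x) ->
  (forall n z, w n z = tensor_map N (v n) z - z) ->
  chain_homotopy u h ->
  @chain_homotopy R (tensor_complex C N) (tensor_complex C N) w
    (fun n => tensor_map N (h n)).
Proof.
move=> uE wE [h0 hS]; split=> [z|n z].
  rewrite wE -(tensor_mapB1 _ (uE 0%N)) [RHS]tensor_map_comp.
  exact: tensor_map_eq.
rewrite wE -(tensor_mapB1 _ (uE n.+1)).
rewrite (@tensor_mapD _ _ _ [the {linear _ -> _} of cdiff C n.+1 \o h n.+1]
  [the {linear _ -> _} of h n \o cdiff C n]); last by move=> x; apply: hS.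
by rewrite -!tensor_map_comp.
Qed.

Lemma tensor_homotopy_equiv C D (N : lmodType R) :
  homotopy_equiv C D -> homotopy_equiv (tensor_complex C N) (tensor_complex D N).
Proof.
move=> [f [g [h [k [fC gC hE kE]]]]].
exists (fun n => tensor_map N (f n)), (fun n => tensor_map N (g n)).
exists (fun n => tensor_map N (h n)), (fun n => tensor_map N (k n)).
split.
- by move=> n z; rewrite /= !tensor_map_comp; apply: tensor_map_eq => x /=; apply: fC.
- by move=> n z; rewrite /= !tensor_map_comp; apply: tensor_map_eq => x /=; apply: gC.
- apply: tensor_homotopy hE => [n x|n z]; last by rewrite /= tensor_map_comp.
  by [].
- apply: tensor_homotopy kE => [n x|n z]; last by rewrite /= tensor_map_comp.
  by [].
Qed.

End HomotopyInvariance.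

(** * Dimensions over the residue field *)

Section RowSpaces.
Variables (F : fieldType) (b : nat).

(** Take [W] of maximal rank among the matrices with row space inside [S]; adding a vector of [S]
    cannot raise the rank. *)
Lemma subspace_mx (S : 'rV[F]_b -> Prop) :
  S 0 -> (forall a u v, S u -> S v -> S (a *: u + v)) ->
  exists W : 'M[F]_b, forall v, S v <-> (v <= W)%MS.
Proof.
move=> S0 SL.
pose inS (W : 'M[F]_b) := forall v : 'rV_b, (v <= W)%MS -> S v.
have ex : exists r, `[< exists2 W, inS W & \rank W = r >].
  exists 0%N; apply/asboolP; exists 0; last by rewrite mxrank0.
  by move=> v; rewrite submx0 => /eqP ->.
case: (@ex_maxnP (fun r => `[< exists2 W, inS W & \rank W = r >]) b ex) => [r|r].
  by move=> /asboolP [W _ <-]; apply: rank_leq_row.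
move=> /asboolP [W WS Wr] rmax; exists W => v; split=> [Sv|]; last exact: WS.
have : (\rank (W + v)%MS <= r)%N.
  apply: rmax; apply/asboolP; exists (W + v)%MS => // u /sub_addsmxP [[c d] /= ->].
  rewrite addrC [d]mx11_scalar mul_scalar_mx; apply: SL => //.
  by apply: WS; apply: submxMl.
rewrite -Wr (geq_leqif (mxrank_leqif_sup (addsmxSl W v))) => WvW.
exact: submx_trans (addsmxSr W v) WvW.
Qed.

End RowSpaces.

Section Dimension.
Variables (R : comNzRingType) (m : idealr R).
Hypotheses (Rn : noetherian R) (Rl : local_ring m).
Implicit Types A B C V : lmodType R.

Lemma resfield_class0 a : resfield_class m a = 0 <-> a \in m.
Proof.
rewrite -[a \in m]/(a \in (m : pred R)) -[X in X \in _]subr0 Quotient.idealrBE.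
rewrite -[X in _ <-> is_true (_ == X)]/(resfield_class m 0) /resfield_class rmorph0.
exact: (rwP eqP).
Qed.

Lemma resfield_class_surj (x : resfield m) : exists a, resfield_class m a = x.
Proof. by exists (repr x); rewrite /resfield_class reprK. Qed.

Fact resfield_inv_ex (x : resfield m) : 
  exists y : resfield m, if x == 0 then y = 0 else y * x = 1.
Proof.
case: eqP => [_|x0]; first by exists 0.
have [a aE] := resfield_class_surj x.
have /(local_unit Rn Rl) [b ba] : a \notin m.
  by apply/negP => /resfield_class0; rewrite aE.
by exists (resfield_class m b); rewrite -aE /resfield_class -rmorphM ba rmorph1.
Qed.

Definition resfield_inv (x : resfield m) : resfield m := sval (cid (resfield_inv_ex x)).

Fact resfield_mulVf (x : resfield m) : x != 0 -> resfield_inv x * x = 1.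
Proof. by rewrite /resfield_inv; case: cid => y /=; case: eqP. Qed.
Fact resfield_inv0 : resfield_inv 0 = 0.
Proof. by rewrite /resfield_inv; case: cid => y /=; rewrite eqxx. Qed.

(** The same carrier as [resfield m], with inverses, so that matrix rank theory applies to it. *)
Definition resfield_field : fieldType :=
  HB.pack (resfield m) (GRing.ComNzRing_isField.Build (resfield m) resfield_mulVf resfield_inv0).

Local Notation F := resfield_field.
Definition res (a : R) : F := resfield_class m a.

Lemma resD a b : res (a + b) = res a + res b.
Proof. exact: rmorphD. Qed.
Lemma resM a b : res (a * b) = res a * res b.
Proof. exact: rmorphM. Qed.
Lemma res_surj (x : F) : exists a, res a = x.
Proof. exact: resfield_class_surj. Qed.

Definition has_dim V b : Prop := lmod_iso V {ffun 'I_b -> resfield m}.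

(** V is a module over R and the row vectors are over k, so coordinates are semilinear along the
    residue map. *)
Lemma has_dimP V b : has_dim V b <-> exists t : V -> 'rV[F]_b,
  [/\ injective t, surj t & forall a x y, t (a *: x + y) = res a *: t x + t y].
Proof.
split=> [/lmod_isoP [f [finj fsurj]]|[t [tinj tsurj tL]]].
  exists (fun x => \row_i f x i); split.
  - move=> x y /rowP xy; apply: finj; apply/ffunP => i.
    by have := xy i; rewrite !mxE.
  - move=> v; have [x xE] := fsurj [ffun i => v 0 i]; exists x.
    by apply/rowP => i; rewrite mxE xE ffunE.
  - by move=> a x y; apply/rowP => i; rewrite !mxE linearP !ffunE.
apply/lmod_isoP; have [a x y|f fE] := @linear_ex R V {ffun 'I_b -> resfield m}
    (fun x => [ffun i => t x 0 i]).
  by apply/ffunP => i; rewrite !ffunE tL !mxE.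
exists f; split=> [x y|g].
  rewrite !fE => /ffunP xy; apply: tinj; apply/rowP => i.
  by have := xy i; rewrite !ffunE.
have [x xE] := tsurj (\row_i g i); exists x.
by rewrite fE; apply/ffunP => i; rewrite ffunE xE mxE.
Qed.

Lemma has_dim_le V a b : has_dim V a -> has_dim V b -> (a <= b)%N.
Proof.
move=> /has_dimP [s [sinj ssurj sL]] /has_dimP [t [tinj tsurj tL]].
have [s' s'E] := choice ssurj.
have s'L (c : F) u v : t (s' (c *: u + v)) = c *: t (s' u) + t (s' v).
  have [d dE] := res_surj c; rewrite -dE -tL; congr (t _).
  by apply: sinj; rewrite sL !s'E.
pose N : 'M[F]_(a, b) := \matrix_i t (s' (delta_mx 0 i)).
have t0 : t (s' 0) = 0.
  have := s'L 1 0 0; rewrite scaler0 addr0 scale1r => /eqP.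
  by rewrite -subr_eq0 opprD addrA subrr sub0r oppr_eq0 => /eqP.
have NE v : v *m N = t (s' v).
  rewrite mulmx_sum_row {2}[v]row_sum_delta.
  elim/big_ind2: _ => [|x1 x2 y1 y2 -> ->|i _].
  - by rewrite t0.
  - by have := s'L 1 x1 y1; rewrite !scale1r.
  - by have := s'L (v 0 i) (delta_mx 0 i) 0; rewrite !addr0 t0 addr0 rowK.
have : row_free N.
  apply: inj_row_free => v; rewrite NE -t0 => /tinj /(congr1 s).
  by rewrite !s'E.
by rewrite /row_free => /eqP <-; apply: rank_leq_col.
Qed.

Lemma has_dim_uniq V a b : has_dim V a -> has_dim V b -> a = b.
Proof.
by move=> ha hb; apply/eqP; rewrite eqn_leq (has_dim_le ha hb) (has_dim_le hb ha).
Qed.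

(** In coordinates of B, the image of A is the row space of a matrix [W]. A gets coordinates from a
    row basis of [W], and C from multiplication by a column basis of the cokernel matrix, whose
    kernel is exactly that row space. *)
Lemma has_dim_ses A B C (i : {linear A -> B}) (p : {linear B -> C}) b :
  ses i p -> has_dim B b ->
  exists a c, [/\ has_dim A a, has_dim C c & b = (a + c)%N].
Proof.
move=> [iinj psurj ker] /has_dimP [t [tinj tsurj tL]].
have t0 : t 0 = 0.
  have := tL 1 0 0; rewrite scaler0 addr0 (_ : res 1 = 1) ?scale1r => [/eqP|].
    by rewrite -subr_eq0 opprD addrA subrr sub0r oppr_eq0 => /eqP.
  exact: rmorph1.
have [||W WE] := @subspace_mx F b (fun v => exists x, t (i x) = v).
- by exists 0; rewrite linear0.
- move=> c _ _ [x <-] [y <-]; have [d <-] := res_surj c.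
  by exists (d *: x + y); rewrite linearP tL.
exists (\rank W), (\rank (cokermx W)); split; last first.
- by rewrite mxrank_coker subnKC // rank_leq_col.
- pose Q := col_base (cokermx W).
  have QE v : v *m Q = 0 <-> exists x, t (i x) = v.
    have -> : (exists x, t (i x) = v) <-> v *m Q *m row_base (cokermx W) == 0.
      by rewrite -mulmxA mulmx_base -submxE.
    by rewrite mulmx_free_eq0 ?row_base_free //; apply: (rwP eqP).
  have [s sE] := choice psurj.
  have sQ x : t (s (p x)) *m Q = t x *m Q.
    apply/eqP; rewrite -subr_eq0 -mulmxBl; apply/eqP/QE.
    have /ker [y yE] : p (s (p x) - x) = 0 by rewrite linearB sE subrr.
    exists y; rewrite yE addrC -scaleN1r tL addrC; congr (_ + _).
    have -> : res (-1) = -1 by apply: rmorphN1.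
    by rewrite scaleN1r.
  apply/has_dimP; exists (fun c => t (s c) *m Q); split.
  + move=> c c' /eqP; rewrite -subr_eq0 -mulmxBl => /eqP /QE [x xE].
    have /(congr1 p) : i x = s c - s c'.
      apply: tinj; rewrite xE addrC [in RHS]addrC -[- s c']scaleN1r tL.
      have -> : res (-1) = -1 by apply: rmorphN1.
      by rewrite scaleN1r.
    rewrite linearB !sE (_ : p (i x) = 0); last by apply/ker; exists x.
    by move=> /esym/eqP; rewrite subr_eq0 => /eqP.
  + move=> u; have [x xE] := tsurj (u *m pinvmx Q); exists (p x).
    by rewrite sQ xE mulmxKpV // submx_full // col_base_full.
  + move=> a x y; have [x' <-] := psurj x; have [y' <-] := psurj y.
    by rewrite -linearP !sQ tL mulmxDl scalemxAl.
pose P := row_base W.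
apply/has_dimP; exists (fun x => t (i x) *m pinvmx P).
have iP x : (t (i x) <= P)%MS by rewrite eq_row_base; apply/WE; exists x.
split.
- move=> x y /(congr1 (mulmx^~ P)); rewrite /= !mulmxKpV //.
  by move=> /tinj /iinj.
- move=> u; have [x xE] : exists x, t (i x) = u *m P.
    by apply/WE; rewrite -(eq_row_base W) submxMl.
  by exists x; rewrite xE mulmxKp // row_base_free.
- by move=> a x y; rewrite linearP tL mulmxDl scalemxAl.
Qed.

Lemma resfield_dimE V b : has_dim V b -> resfield_dim m V = b.
Proof.
move=> Vb; apply: classical_sets.xget_unique => // c Vc.
exact: has_dim_uniq Vc Vb.
Qed.

Lemma has_dim_iso U V b : lmod_iso U V -> has_dim V b -> has_dim U b.
Proof. exact: lmod_iso_trans. Qed.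

(** Here t n is the dimension of the boundaries in degree n. The equations come from 0 -> B_n -> Z_n
    -> H_n -> 0 and 0 -> Z_(n+1) -> C_(n+1) -> B_n -> 0. *)
Lemma homology_dims (C : complex R) (a : nat -> nat) :
  (forall n, has_dim (C n) (a n)) ->
  exists h t : nat -> nat, [/\ forall n, has_dim (homology C n) (h n),
    a 0%N = (t 0%N + h 0%N)%N & forall n, a n.+1 = (t n + t n.+1 + h n.+1)%N].
Proof.
move=> Ca.
pose Z n : lmodType R := submod (@cycles R C n).
pose B n : lmodType R := submod (@boundary_cycles R C n).
have ZB n z : has_dim (Z n) z -> exists t h,
    [/\ has_dim (B n) t, has_dim (homology C n) h & z = (t + h)%N].
  apply: (@has_dim_ses _ _ _ (submod_incl _) (quotmod_proj (@boundary_cycles R C n))).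
  split; [exact: submod_incl_inj | exact: quotmod_proj_surj |].
  move=> x; rewrite quotmod_proj0; split=> [xB|[y <-]]; last exact: (valP y).
  by exists (@SubMod R _ (@boundary_cycles R C n) x xB).
have CZ n : exists z t, [/\ has_dim (Z n.+1) z, has_dim (B n) t & a n.+1 = (z + t)%N].
  pose incl := [the {linear B n -> C n} of
    submod_incl (@cycles R C n) \o submod_incl (@boundary_cycles R C n)].
  have [x|c x y x' y' xy x'y'|y|d dE] := @lin_of_rel R (C n.+1) (B n)
      (fun x y => val (val y) = cdiff C n x).
  - have yB : @SubMod R (C n) (@cycles R C n) (cdiff C n x) (boundary_cycle x)
        \in @boundary_cycles R C n by apply/asboolP; exists x.
    by exists (SubMod yB).
  - rewrite linearP -xy -x'y'.
    exact: (linearP incl).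
  - rewrite linear0 => y0; apply: val_inj; apply: val_inj; rewrite y0.
    exact/esym/(linear0 incl).
  apply: (@has_dim_ses _ _ _ (submod_incl (@cycles R C n.+1)) d); last exact: Ca.
  split; first exact: submod_incl_inj.
    move=> y; have /asboolP [x xE] := valP y.
    by exists x; apply: val_inj; apply: val_inj; rewrite dE.
  move=> x; split=> [dx|[y <-]].
    have xZ : x \in @cycles R C n.+1.
      apply/eqP; rewrite -dE dx.
      exact: (linear0 incl).
    by exists (SubMod xZ).
  apply: val_inj; apply: val_inj; rewrite dE.
  rewrite [RHS](linear0 incl).
  exact/eqP/(valP y).
have Z0 : has_dim (Z 0%N) (a 0%N).
  apply: has_dim_iso (Ca 0%N).
  apply/lmod_isoP; exists (submod_incl (@cycles R C 0)); split.
    exact: submod_incl_inj.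
  by move=> x; exists (@SubMod R (C 0%N) (@cycles R C 0) x isT).
have Bt n : exists t h, [/\ has_dim (B n) t, has_dim (homology C n) h &
    forall z, has_dim (Z n) z -> z = (t + h)%N].
  have [z Zz] : exists z, has_dim (Z n) z.
    by case: n => [|n]; [exists (a 0%N) | have [z [t [Zz _ _]]] := CZ n; exists z].
  have [t [h [Bt Hh zE]]] := ZB n z Zz; exists t, h; split=> // z' Zz'.
  by rewrite -zE; apply: has_dim_uniq Zz' Zz.
have [t tP] := choice Bt; have [h hP] := choice tP.
exists h, t; split=> [n||n].
- by have [] := hP n.
- by have [_ _] := hP 0%N; apply.
- have [z [t' [Zz Bt' ->]]] := CZ n.
  have [_ _ /(_ z Zz) ->] := hP n.+1.
  have [Bn _ _] := hP n; rewrite (has_dim_uniq Bt' Bn).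
  by rewrite addnC addnA.
Qed.

(** By minimality, the coordinates of a preimage of x are determined modulo m. This gives a bilinear
    map from M and k to k^n; the inverse sends the i-th unit vector to p(e_i) tensored with 1. *)
Lemma tensor_dim n (M : lmodType R) (p : {linear 'rV[R]_n -> M}) :
  minimal_cover m p -> has_dim (tensor M (resfield m)) n.
Proof.
move=> [psurj pm].
have [s sE] := choice psurj.
have resE (v w : 'rV[R]_n) i : p v = p w -> res (v 0 i) = res (w 0 i).
  move=> pvw; apply/eqP; rewrite -subr_eq0 -[X in X == _](rmorphB (\pi_{ideal_quot m}%qT)).
  apply/eqP/resfield_class0.
  by have := pm (v - w); rewrite !linearB pvw subrr => /(_ erefl i); rewrite !mxE.
pose f (x : M) (c : resfield m) : {ffun 'I_n -> resfield m} :=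
  [ffun i => (res (s x 0 i) : resfield m) * c].
have fbil : bilinear_for *:%R *:%R f.
  split=> [c a x x'|x a c c'] /=; apply/ffunP => i; rewrite !ffunE.
    have -> : res (s (a *: x + x') 0 i) = res (a * s x 0 i + s x' 0 i).
      have := @resE (s (a *: x + x')) (a *: s x + s x') i.
      by rewrite linearP !sE => /(_ erefl) ->; rewrite !mxE.
    by rewrite resD resM mulrDl -mulrA.
  by rewrite mulrDr; congr (_ + _); rewrite mulrCA.
pose fB : {bilinear M -> resfield m -> {ffun 'I_n -> resfield m}} :=
  HB.pack f (bilinear_isBilinear.Build R M (resfield m) {ffun 'I_n -> resfield m}
    *:%R *:%R f fbil).
pose phi : {linear tensor M (resfield m) -> {ffun 'I_n -> resfield m}} :=
  [the {linear _ -> _} of tensor_lift fB].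
have phiE x c : phi (pure_tensor x c) = f x c by apply: tensor_liftE.
have [psi psiE] : exists psi : {linear {ffun 'I_n -> resfield m} -> tensor M (resfield m)},
    forall g : {ffun 'I_n -> resfield m}, psi g = \sum_i pure_tensor (p (delta_mx 0 i)) (g i).
  apply: linear_ex => a g h; rewrite scaler_sumr -big_split; apply: eq_bigr => i _.
  by rewrite !ffunE linearDr linearZr.
exists phi, psi.
  move=> z; rewrite -[LHS]/([the {linear _ -> _} of psi \o phi] z).
  rewrite -[RHS]/([the {linear _ -> _} of idfun] z).
  apply: tensor_ext => x c /=; rewrite phiE psiE -[x in RHS]sE rV_lin_sum linear_sumlz.
  apply: eq_bigr => i _; rewrite linearZl_LR -linearZr ffunE.
  by [].
move=> g; rewrite psiE linear_sum; apply/ffunP => i; rewrite sum_ffunE (bigD1 i) //=.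
rewrite phiE ffunE (@resE _ (delta_mx 0 i)) ?sE // mxE !eqxx big1 ?addr0.
  by rewrite [res 1]rmorph1 mul1r.
move=> j ji; rewrite phiE ffunE (@resE _ (delta_mx 0 j)) ?sE // mxE eq_sym (negPf ji) andbF.
by rewrite [res 0]rmorph0 mul0r.
Qed.

End Dimension.

(** * Alternating sums and the G-Euler characteristic *)

Section Euler.
Variables (R : comNzRingType) (m : idealr R).
Hypotheses (Rn : noetherian R) (Rl : local_ring m).
Implicit Types K G M : lmodType R.

Fixpoint euler (s : seq nat) : int :=
  if s is a :: s' then a%:Z - euler s' else 0.

Lemma eulerE s : euler s = \sum_(n < size s) (-1) ^+ n * (nth 0%N s n)%:Z.
Proof.
elim: s => [|a s IHs]; first by rewrite big_ord0.
rewrite big_ord_recl expr0 mul1r /= IHs -sumrN; congr (_ + _).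
by apply: eq_bigr => i _; rewrite exprS mulN1r mulNr.
Qed.

(** Truncation at N leaves the boundaries in degree N as a defect, which disappears when N is the
    top degree. *)
Lemma alternating_homology (a h t : nat -> nat) N :
  a 0%N = (t 0%N + h 0%N)%N -> (forall n, a n.+1 = (t n + t n.+1 + h n.+1)%N) ->
  \sum_(n < N.+1) (-1) ^+ n * (h n)%:Z =
  \sum_(n < N.+1) (-1) ^+ n * (a n)%:Z - (-1) ^+ N * (t N)%:Z :> int.
Proof.
move=> a0 aS; elim: N => [|N IHN].
  by rewrite !big_ord_recl !big_ord0 /= a0 PoszD; ring.
by rewrite big_ord_recr IHN [in RHS]big_ord_recr /= aS !PoszD !exprS; ring.
Qed.

Lemma minimal_cover_id n : minimal_cover m ([the {linear 'rV[R]_n -> 'rV[R]_n} of idfun]).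
Proof.
split=> [y|v v0 i]; first by exists y.
by rewrite (_ : v = 0) // mxE idealr0.
Qed.

Lemma G_Euler_charE K G M (i : {linear K -> G}) (p : {linear G -> M}) s nu :
  ses i p -> free_res s K -> totally_reflexive G ->
  has_dim m (tensor G (resfield m)) nu -> G_Euler_char m M = euler (nu :: s).
Proof.
move=> e Ks Gt Gnu; have [A0 [A0res A0n A0lift]] := free_res_resolution Rn Ks.
pose A := splice e A0.
have At n : totally_reflexive (A n).
  case: n => [//|n]; rewrite [A n.+1]A0n.
  apply: (totally_reflexive_free Rn (n := nth 0%N s n)).
  by exists [the {linear _ -> _} of idfun]; exists id.
have Alift H : totally_reflexive H -> lifts H (plus_complex A).
  move=> /(totally_reflexiveP Rn) [Hp _ _]; apply: splice_lifts; last exact: A0lift.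
  exact: (perp_lift Rn e Ks Hp).
have Aproper : proper_G_resolution A.
  split; first by split; [apply: splice_resolution|].
  by move=> H Ht; apply/exact_hom_complexP/Alift.
have Adim n : has_dim m (tensor_complex A (resfield m) n) (nth 0%N (nu :: s) n).
  case: n => [//|n]; rewrite /= A0n.
  exact: (tensor_dim Rn Rl (minimal_cover_id _)).
have [h [t [hdim a0 aS]]] := homology_dims Rn Rl Adim.
(* [rel_Tor] uses some chosen proper G-resolution B. The terms of A and B are totally reflexive, so
   each complex lifts against the other and the two are homotopy equivalent. *)
have betti n : rel_betti m n M = h n.
  apply: (resfield_dimE Rn Rl); rewrite /rel_Tor; case: pselect => [ex|]; last first.
    by case; exists A.
  apply: has_dim_iso (hdim n); case: cid => B [[Bres Bt] Bprop] /=.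
  apply: homotopy_equiv_homology; apply: tensor_homotopy_equiv.
  apply: (@resolution_homotopy_equiv R M B A) => j; try exact: Alift.
    exact/exact_hom_complexP/Bprop.
  exact/exact_hom_complexP/Bprop.
have s0 n : (size s < n)%N -> nth 0%N (nu :: s) n = 0%N.
  by move=> ns; rewrite nth_default.
(* The last entry of [nu :: s] has index [size s]; the complex vanishes one degree above, so there
   are no boundaries in degree [size s]. *)
have t0 : t (size s) = 0%N.
  by have := aS (size s); rewrite s0 // => /esym/eqP; rewrite -addnA addn_eq0 => /andP [/eqP].
have h0 n : (size s < n)%N -> h n = 0%N.
  case: n => [//|n] ns; have := aS n; rewrite s0 // => /esym/eqP.
  by rewrite addn_eq0 => /andP [_ /eqP].
rewrite /G_Euler_char (@fsbigE _ _ _ _ _ (iota 0 (size s).+1)) ?iota_uniq //; last first.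
  move=> n _; rewrite mem_iota add0n /= -leqNgt => ns.
  by rewrite betti h0 // mulr0.
transitivity (\sum_(n < (size s).+1) (-1) ^+ n * (h n)%:Z : int).
  rewrite -(big_mkord xpredT (fun n => (-1) ^+ n * (h n)%:Z)) /index_iota subn0.
  by apply: eq_big => n; [rewrite in_setT | rewrite betti].
by rewrite (alternating_homology _ a0 aS) t0 mulr0 subr0 eulerE.
Qed.

End Euler.

(** * Rank *)

Section PrimeAvoidance.
Variable R : comNzRingType.
Hypothesis Rn : noetherian R.

Definition regular (a : R) : Prop := forall x, a * x = 0 -> x = 0.

Lemma regularM a b : regular a -> regular b -> regular (a * b).
Proof. by move=> ra rb x; rewrite -mulrA => /ra /rb. Qed.

(* The annihilator of x is maximal among the annihilators of nonzero elements;
   these annihilators are the maximal associated primes of R. *)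
Definition max_ann (x : R) : Prop := x <> 0 /\
  forall y, y <> 0 -> (forall a, a * x = 0 -> a * y = 0) ->
  forall a, a * y = 0 -> a * x = 0.

(** The annihilator of bx contains that of x, so by maximality it equals it; if abx = 0, then a
    annihilates x. *)
Lemma max_ann_prime x a b : max_ann x -> a * x <> 0 -> b * x <> 0 -> a * b * x <> 0.
Proof.
move=> [x0 xmax] ax bx; rewrite -mulrA => abx; apply: ax.
apply: xmax bx _ _ abx => c cx.
by rewrite mulrCA cx mulr0.
Qed.

(** Annihilators of nonzero elements killed by [a] have a maximal member. It is maximal among all
    annihilators, because a larger one still contains [a]. *)
Lemma max_ann_ex a x : x <> 0 -> a * x = 0 -> exists2 y, max_ann y & a * y = 0.
Proof.
move=> x0 ax.
pose F (I : R -> Prop) := exists y, [/\ y <> 0, a * y = 0 & forall b, I b <-> b * y = 0].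
have [||I [y [y0 ay IE]] Imax] := @ideal_acc R F (fun b => b * x = 0) Rn.
- by exists x.
- move=> I [y [_ _ IE]]; split; first by apply/IE; rewrite mul0r.
  move=> b c d /IE cy /IE dy; apply/IE.
  by rewrite mulrDl -mulrA cy dy mulr0 addr0.
exists y => //; split=> // z z0 yz b bz; apply/IE.
apply: (Imax (fun b => b * z = 0)) => //; last by move=> c /IE /yz.
by exists z; split=> //; apply: yz.
Qed.

Fixpoint in_span (s : seq R) (z : R) : Prop :=
  if s is x :: s' then exists c z', in_span s' z' /\ z = c * x + z' else z = 0.

Lemma in_span_ideal s : is_ideal (in_span s).
Proof.
elim: s => [|x s [I0 IL]] /=.
  by split=> // a x y -> ->; rewrite mulr0 addr0.
split; first by exists 0, 0; rewrite mul0r addr0.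
move=> a _ _ [c [z [zs ->]]] [c' [z' [zs' ->]]].
by exists (a * c + c'), (a * z + z'); split; [apply: IL | ring].
Qed.

(** Choose [s] with maximal span, so that every y with [max_ann y] lies in it. If no ann(x) with x
    in [s] is contained in ann(y), pick an element of each ann(x) outside ann(y): their product
    kills the span, but by primeness it does not kill y. *)
Lemma max_ann_finite : exists s : seq R, (forall x, x \in s -> max_ann x) /\
  forall y, max_ann y -> exists2 x, x \in s & forall a, a * x = 0 -> a * y = 0.
Proof.
pose F (I : R -> Prop) := exists s, (forall x, x \in s -> max_ann x) /\
   (forall z, I z <-> in_span s z).
have [||I [s [smax IE]] Imax] := @ideal_acc R F (in_span [::]) Rn.
- by exists [::].
- move=> I [s [_ IE]]; have [I0 IL] := in_span_ideal s; split; first exact/IE.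
  by move=> a x y /IE Ix /IE Iy; apply/IE/IL.
exists s; split=> // y ymax.
have {Imax IE} : in_span s y.
  apply/IE; apply: (Imax (in_span (y :: s))) => [|a /IE ?|].
  - exists (y :: s); split=> // x; rewrite inE => /orP [/eqP -> //|]; exact: smax.
  - by exists 0, a; rewrite mul0r add0r.
  - by exists 1, 0; rewrite mul1r addr0; split=> //; case: (in_span_ideal s).
move=> sy; apply: contrapT => nx.
have {}nx x : x \in s -> exists2 a, a * x = 0 & a * y <> 0.
  move=> xs; apply: contrapT => na; apply: nx; exists x => // a ax.
  by apply: contrapT => ay; apply: na; exists a.
suff [a az ay] : exists2 a, (forall z, in_span s z -> a * z = 0) & a * y <> 0.
  by apply: ay; apply: az.
elim: s {smax sy} nx => [|x s IHs] nx /=.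
  by exists 1 => [z ->|]; [rewrite mulr0 | rewrite mul1r; case: ymax].
have [|a az ay] := IHs.
  by move=> x' xs; apply: nx; rewrite inE xs orbT.
have [|b bx bY] := nx x; first by rewrite mem_head.
exists (a * b); last exact: max_ann_prime.
move=> _ [c [z [/az az0 ->]]].
rewrite mulrDr -[a * b * z]mulrAC az0 mul0r addr0.
have -> : a * b * (c * x) = a * c * (b * x) by ring.
by rewrite bx mulr0.
Qed.

(* If w avoids the primes ann(y), y in s, but w x = 0, then w + t v_j avoids all
   of them, for t in every ann(y) but not in ann(x), and v_j not in ann(x). *)
Lemma avoid_max_ann (s : seq R) n (v : 'rV[R]_(1 + n)) :
  (forall x, x \in s -> max_ann x) -> (forall a, a *: v = 0 -> a = 0) ->
  exists c : 'cV[R]_n, forall x, x \in s ->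
    (lsubmx v + rsubmx v *m c) 0 0 * x <> 0.
Proof.
move=> smax vfaith; elim: s smax => [|x s IHs] smax; first by exists 0.
have [|c cs] := IHs; first by move=> y ys; apply: smax; rewrite inE ys orbT.
have xmax : max_ann x by apply: smax; rewrite mem_head.
set w := (_ + _) in cs; case: (pselect (w 0 0 * x = 0)) => [wx|wx]; last first.
  by exists c => y; rewrite inE => /orP [/eqP ->|/cs].
have [t ts tx] : exists2 t, (forall y, y \in s -> t * y = 0) & t * x <> 0.
  have {}cs y : y \in s -> exists2 a, a * y = 0 & a * x <> 0.
    move=> ys; apply: contrapT => na; apply: (cs y ys).
    have ymax : max_ann y by apply: smax; rewrite inE ys orbT.
    apply: (ymax.2 x xmax.1) wx => a ay; apply: contrapT => ax.
    by apply: na; exists a.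
  elim: s {IHs smax} cs => [|y s IHs] cs.
    by exists 1 => //; rewrite mul1r; case: xmax.
  have [|t ts tx] := IHs; first by move=> z zs; apply: cs; rewrite inE zs orbT.
  have [|a ay ax] := cs y; first by rewrite mem_head.
  exists (a * t); last exact: max_ann_prime.
  move=> z; rewrite inE => /orP [/eqP ->|/ts tz].
    by rewrite mulrAC ay mul0r.
  by rewrite -mulrA tz mulr0.
have [j jx] : exists j, rsubmx v 0 j * x <> 0.
  apply: contrapT => nj; apply: xmax.1; apply: vfaith.
  have rv j : rsubmx v 0 j * x = 0 by apply: contrapT => h; apply: nj; exists j.
  have lv : lsubmx v 0 0 * x = 0.
    move: wx; rewrite /w !mxE mulrDl mulr_suml big1 ?addr0 // => i _.
    by rewrite mulrAC rv mul0r.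
  rewrite -[v]hsubmxK scale_row_mx -[RHS]row_mx0; congr row_mx; apply/rowP => i.
    by rewrite [i]ord1 mxE mulrC lv mxE.
  by rewrite mxE mulrC rv mxE.
exists (c + t *: delta_mx j 0) => y.
have -> : (lsubmx v + rsubmx v *m (c + t *: delta_mx j 0)) 0 0 = w 0 0 + t * rsubmx v 0 j.
  rewrite mulmxDr addrA mxE -/w -scalemxAr; congr (_ + _); rewrite mxE; congr (_ * _).
  by rewrite -colE mxE.
rewrite inE mulrDl => /orP [/eqP ->|ys].
  by rewrite wx add0r; apply: max_ann_prime.
by rewrite mulrAC ts // mul0r addr0; apply: cs.
Qed.

(** The first coordinate of [v] has coefficient 1, so the linear form has a free kernel,
    parametrized by the other coordinates. *)
Lemma regular_combination n (v : 'rV[R]_(1 + n)) :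
  (forall a, a *: v = 0 -> a = 0) ->
  exists c : 'cV[R]_n, regular ((lsubmx v + rsubmx v *m c) 0 0).
Proof.
move=> vfaith; have [s [smax sall]] := max_ann_finite.
have [c cs] := avoid_max_ann smax vfaith; exists c.
move=> x wx; apply: contrapT => x0.
have [y ymax wy] := max_ann_ex x0 wx.
have [z zs zy] := sall y ymax.
by apply: (cs z zs); apply: (smax z zs).2 ymax.1 zy _ wy.
Qed.

End PrimeAvoidance.

(** * Ranks through bases up to torsion *)

Section Rank.
Variable R : comNzRingType.
Implicit Types A B C F K M : lmodType R.

(* A basis of U^-1 M can be chosen in M; this allows computing with ranks without
   localizing. *)
Definition torsion_basis M r (f : {linear 'rV[R]_r -> M}) : Prop :=
  injective f /\ forall x, exists u, regular u /\ exists v, u *: x = f v.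

Definition rank_of M r : Prop := exists f : {linear 'rV[R]_r -> M}, torsion_basis f.

Lemma regular_rV n (u : R) (v : 'rV[R]_n) : regular u -> u *: v = 0 -> v = 0.
Proof.
move=> ru /rowP uv; apply/rowP => i; rewrite mxE; apply: ru.
by have := uv i; rewrite !mxE.
Qed.

Lemma rank_of_id n : rank_of 'rV[R]_n n.
Proof.
exists [the {linear 'rV[R]_n -> 'rV[R]_n} of idfun]; split=> // x.
by exists 1; split=> [y|]; [rewrite mul1r | exists x; rewrite scale1r].
Qed.

Lemma rank_of_ses A B C (i : {linear A -> B}) (p : {linear B -> C}) a c :
  ses i p -> rank_of A a -> rank_of C c -> rank_of B (a + c).
Proof.
move=> e [f [finj fspan]] [g [ginj gspan]]; have [iinj psurj ker] := e.
have [h hE] := projective_lift g (@rV_projective R c) psurj.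
have [k kE] : exists k : {linear 'rV[R]_(a + c) -> B},
    forall x : 'rV_(a + c), k x = i (f (lsubmx x)) + h (rsubmx x).
  by apply: linear_ex => r x y; rewrite !linearP scalerDr addrACA.
exists k; split.
  apply: linear_inj => x; rewrite kE => kx.
  have rx : rsubmx x = 0.
    apply: ginj; rewrite linear0 -hE; have := congr1 p kx.
    by rewrite linearD (ses_comp e) add0r linear0.
  have lx : lsubmx x = 0.
    by apply: finj; apply: iinj; rewrite !linear0 -[RHS]kx rx linear0 addr0.
  by rewrite -[x]hsubmxK lx rx row_mx0.
move=> x; have [u [ru [v uv]]] := gspan (p x).
have /ker [y yE] : p (u *: x - h v) = 0 by rewrite linearB hE linearZ /= uv subrr.
have [u' [ru' [v' uv']]] := fspan y.
exists (u' * u); split; first exact: regularM.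
exists (row_mx v' (u' *: v)); rewrite kE row_mxKl row_mxKr -uv' !linearZ /= yE.
by rewrite -scalerDr subrK scalerA.
Qed.

Hypothesis Rn : noetherian R.

(* Given a basis extending the first a vectors, the next one x0 satisfies
   u x0 = f v + w z0 with v faithful; regular_combination yields a linear form l
   with l v regular, and the new basis comes from ker l. *)
Lemma torsion_basis_complete F b a (w : {linear 'rV[R]_a -> F}) :
  rank_of F b -> injective w ->
  exists c (f : {linear 'rV[R]_c -> F}), [/\ b = (a + c)%N,
    forall y z, f y = w z -> y = 0 &
    forall x, exists u, regular u /\ exists y z, u *: x = f y + w z].
Proof.
move=> [f0 [f0inj f0span]].
elim: a w => [|a IHa] w winj.
  exists b, f0; split=> [//|y z fy|x].
    by apply: f0inj; rewrite fy (_ : z = 0) ?linear0 //; apply/rowP; case.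
  have [u [ru [v uv]]] := f0span x; exists u; split=> //; exists v, 0.
  by rewrite linear0 addr0.
have [i iE] : exists i : {linear 'rV[R]_a -> 'rV[R]_(1 + a)}, forall z, i z = row_mx 0 z.
  by apply: linear_ex => r x y; rewrite scale_row_mx add_row_mx scaler0 addr0.
pose x0 : F := w (row_mx 1%:M 0 : 'rV_(1 + a)).
have wrow (z : 'rV[R]_(1 + a)) : w z = (lsubmx z 0 0) *: x0 + w (i (rsubmx z)).
  have zE : z = lsubmx z 0 0 *: row_mx 1%:M 0 + i (rsubmx z).
    rewrite iE scale_row_mx scaler0 add_row_mx addr0 add0r -[LHS]hsubmxK; congr row_mx.
    by apply/rowP => j; rewrite [j]ord1 !mxE mulr1.
  by rewrite {1}zE linearD linearZ.
have [|c [f [bE fw fspan]]] := IHa [the {linear 'rV[R]_a -> F} of w \o i].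
  move=> x y /= /winj /(congr1 (fun z : 'rV[R]_(1 + a) => rsubmx z)).
  by rewrite !iE !row_mxKr.
have [u [ru [v [z0 uv]]]] := fspan x0.
have wr (r s : R) z : w (row_mx (r *: s%:M) z : 'rV_(1 + a)) = r *: (s *: x0) + w (i z).
  by rewrite wrow row_mxKl row_mxKr !mxE mulr1n scalerA.
have wiL r s y z : w (i (r *: y + s *: z)) = r *: w (i y) + s *: w (i z).
  by rewrite !linearD !linearZ.
(* If r v = 0, then r u x0 = r w(z0); injectivity of [w] gives r u = 0, and [u] is regular. *)
have vfaith r : r *: v = 0 -> r = 0.
  move=> rv; have : w (row_mx (r *: u%:M) (- (r *: z0)) : 'rV_(1 + a)) = 0.
    rewrite wr uv /= scalerDr -[r *: f v]linearZ rv linear0 add0r.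
    by rewrite !linearN !linearZ /= -scalerDr subrr scaler0.
  rewrite -(linear0 w) => /winj /(congr1 (fun z : 'rV[R]_(1 + a) => lsubmx z 0 0)).
  rewrite row_mxKl !mxE mulr1n mulrC.
  exact: ru.
(* For c = 0 the vector [v] is zero and 1 annihilates it, contradicting [vfaith]. So a vector is
   available for the exchange. *)
case: c f bE fw fspan v uv vfaith => [|c] f bE fw fspan v uv vfaith.
  have /vfaith /eqP : 1 *: v = 0 by apply/rowP; case.
  by rewrite oner_eq0.
have fv : f v = u *: x0 - w (i z0) by rewrite uv /= addrK.
have [d dreg] := @regular_combination R Rn c v vfaith.
have [l lE] : exists l : {linear 'rV[R]_(1 + c) -> R^o},
    forall y, l y = (lsubmx y + rsubmx y *m d) 0 0.
  apply: linear_ex => r x y; rewrite !linearP mulmxDl -scalemxAl addrACA -scalerDr.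
  have mx11D (A B : 'M[R]_1) : (r *: A + B) 0 0 = r * A 0 0 + B 0 0 by rewrite !mxE.
  exact: mx11D.
have lZ r y : l (r *: y) = r * l y by rewrite linearZ.
(* [k] parametrizes the kernel of [l]; this is where the coefficient 1 of the first coordinate is
   used. *)
have [k kE] : exists k : {linear 'rV[R]_c -> 'rV[R]_(1 + c)},
    forall y, k y = row_mx (- (y *m d)) y.
  apply: linear_ex => r x y; rewrite scale_row_mx add_row_mx mulmxDl -scalemxAl.
  by rewrite opprD scalerN.
have lk y : l (k y) = 0 by rewrite lE kE row_mxKl row_mxKr addNr mxE.
have kl y : l y = 0 -> k (rsubmx y) = y.
  move=> ly; rewrite kE -[RHS]hsubmxK; congr row_mx; apply/rowP => j.
  apply/eqP; rewrite [j]ord1 mxE eq_sym -subr_eq0 opprK; apply/eqP.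
  by move: ly; rewrite lE mxE.
exists c, [the {linear 'rV[R]_c -> F} of f \o k]; split.
- by rewrite bE addSn addnS.
- move=> y z0'; pose z : 'rV[R]_(1 + a) := z0'.
  (* Multiplying by [u] and eliminating u x0 gives u k(y) = t v; applying [l] yields t l(v) = 0,
     hence t = 0. *)
  rewrite -[w _]/(w z) wrow /=; set t := lsubmx z 0 0 => fky.
  have ul : u *: k y - t *: v = 0.
    apply: (fw _ (t *: z0 + u *: rsubmx z)).
    rewrite linearB !linearZ /= fky fv wiL.
    rewrite opprB scalerDr scalerBr !scalerA [u * t]mulrC addrC addrA.
    by rewrite subrK.
  have t0 : t = 0.
    apply: dreg; rewrite -lE mulrC.
    have := congr1 l ul; rewrite linearB !lZ lk mulr0 sub0r linear0.
    by move=> /eqP; rewrite oppr_eq0 => /eqP.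
  move: ul; rewrite t0 scale0r subr0 => /(regular_rV ru) ky0.
  by have := congr1 rsubmx ky0; rewrite kE row_mxKr linear0.
- move=> x; have [u1 [ru1 [y [z xE]]]] := fspan x.
  exists (l v * u1); split; first by apply: regularM => //; rewrite lE.
  (* The component of l(v) y in the kernel of [l]; the remainder l(y) f(v) is a combination of x0
     and earlier vectors. *)
  pose q : 'rV[R]_(1 + c) := l v *: y - l y *: v.
  have kq : k (rsubmx q) = q by apply: kl; rewrite linearB !lZ mulrC subrr.
  have fq : f q = l v *: f y - l y *: (u *: x0 - w (i z0)).
    by rewrite -fv -!linearZ -linearB.
  exists (rsubmx q), (row_mx (l y *: u%:M) (l v *: z + - l y *: z0)).
  rewrite wr /= kq fq -scalerA xE scalerDr wiL scaleNr scalerBr opprB -addrA.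
  by congr (_ + _); rewrite addrA subrK addrC subrK.
Qed.

(** A basis of K up to torsion is completed in F; the added vectors map to a basis of M up to
    torsion. *)
Lemma rank_of_quotient K F M (i : {linear K -> F}) (p : {linear F -> M}) a b :
  ses i p -> rank_of K a -> rank_of F b -> exists c, b = (a + c)%N /\ rank_of M c.
Proof.
move=> [iinj psurj ker] [g [ginj gspan]] Fb.
have [|c [f [bE fw fspan]]] := @torsion_basis_complete F b a [the {linear _ -> F} of i \o g] Fb.
  by move=> x y /= /iinj /ginj.
exists c; split=> //; exists [the {linear 'rV[R]_c -> M} of p \o f]; split.
  apply: linear_inj => y /= /ker [k kE].
  have [u [ru [z uk]]] := gspan k.
  apply: (regular_rV ru); apply: (fw _ z).
  by rewrite linearZ /= -kE -linearZ uk.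
move=> y; have [x <-] := psurj y; have [u [ru [v [z uE]]]] := fspan x.
exists u; split=> //; exists v; rewrite -linearZ uE linearD /=.
by rewrite (_ : p (i _) = 0) ?addr0 //; apply/ker; exists (g z).
Qed.

Lemma free_res_rank s M : free_res s M -> exists r : nat, rank_of M r /\ euler s = r%:Z.
Proof.
elim: s M => [|a s IHs] M /=.
  move=> M0; exists 0%N; split=> //; exists [the {linear 'rV[R]_0 -> M} of \0]; split.
    by move=> x y _; apply/rowP; case.
  move=> x; exists 1; split=> [y|]; first by rewrite mul1r.
  by exists 0; rewrite (M0 x) scaler0.
case=> K [i [p [e /IHs [k [Kk sk]]]]].
have [c [aE Mc]] := rank_of_quotient e Kk (rank_of_id a).
by exists c; split=> //; rewrite sk aE PoszD addrC addKr.
Qed.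

(** Lift a basis of M to n independent vectors of R^n. Their completion adds nothing, so some
    regular multiple of a kernel vector y is a combination of them; applying [p] shows that the
    coefficients vanish, and R^n is torsion-free. *)
Lemma surj_rank_inj n M (p : {linear 'rV[R]_n -> M}) :
  surj p -> rank_of M n -> injective p.
Proof.
move=> psurj [f [finj fspan]].
have [g gE] := projective_lift f (@rV_projective R n) psurj.
have [|c [h [nE hg hspan]]] := torsion_basis_complete (w := g) (rank_of_id n).
  by move=> x y gxy; apply: finj; rewrite -!gE gxy.
have c0 : c = 0%N by apply/eqP; rewrite -(eqn_add2l n) -nE addn0.
apply: linear_inj => y py; have [u [ru [v [z uy]]]] := hspan y.
apply: (regular_rV ru); rewrite uy (_ : v = 0); last by subst c; apply/rowP; case.
rewrite linear0 add0r (_ : z = 0) ?linear0 //; apply: finj.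
rewrite linear0 -gE; have := congr1 p uy; rewrite linearZ /= py scaler0 linearD.
by rewrite (_ : h v = 0) ?linear0 ?add0r // (_ : v = 0) ?linear0 //; subst c; apply/rowP; case.
Qed.

End Rank.

(** * Comparison with rank over the total ring of fractions *)

Section TotalFractionRank.
Variable R : comNzRingType.
Implicit Types M : lmodType R.
Local Notation T := (total_frac R).

Lemma nzd_regular (u : nzd R) : regular (nzd_val u).
Proof.
move=> x ux; have /asboolP ureg := nzd_lreg u.
by apply: ureg; rewrite mulr0.
Qed.

Lemma regular_nzd (u : R) : regular u -> exists v : nzd R, nzd_val v = u.
Proof.
move=> ru; have ul : `[< GRing.lreg u >].
  apply/asboolP => x y /eqP; rewrite -subr_eq0 -mulrBr => /eqP /ru /eqP.
  by rewrite subr_eq0 => /eqP.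
by exists (Nzd ul).
Qed.

Definition to_loc M (x : M) : loc M := Defs.frac x (nzd1 R).
Definition to_total (a : R) : T := @to_loc R^o a.

Lemma to_locD M : {morph @to_loc M : x y / x + y}.
Proof.
by move=> x y; rewrite /to_loc [RHS]loc_addE !scale1r nzd_mul1.
Qed.

Lemma to_loc_eq M (x y : M) : to_loc x = to_loc y <-> exists2 u, regular u & u *: x = u *: y.
Proof.
rewrite fracP /= !scale1r; split=> [[u uE]|[u ru uE]].
  by exists (nzd_val u) => //; apply: nzd_regular.
by have [v vE] := regular_nzd ru; exists v; rewrite vE.
Qed.

Lemma fracZ M (a : R) s (x : M) t :
  (Defs.frac (a : R^o) s : T) *: Defs.frac x t = Defs.frac (a *: x) (nzd_mul s t).
Proof. exact: loc_scaleE. Qed.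

Lemma to_locZ M a (x : M) : to_loc (a *: x) = to_total a *: to_loc x.
Proof. by rewrite fracZ nzd_mul1. Qed.

Lemma fracM (a b : R) s t :
  (Defs.frac (a : R^o) s : T) * (Defs.frac (b : R^o) t : T) =
  Defs.frac (a * b : R^o) (nzd_mul s t).
Proof. exact: (@loc_scaleE R R^o). Qed.

Lemma to_totalM a b : to_total (a * b) = to_total a * to_total b.
Proof. by rewrite fracM nzd_mul1. Qed.

Lemma to_total_frac M (x : M) s : to_total (nzd_val s) *: Defs.frac x s = to_loc x.
Proof.
rewrite fracZ; apply/fracP; exists (nzd1 R).
by rewrite /= !scale1r mul1r.
Qed.

Lemma to_totalK s : to_total (nzd_val s) * (Defs.frac (1 : R^o) s : T) = 1.
Proof. exact: (@to_total_frac R^o). Qed.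

Lemma to_loc_sum M (I : finType) (F : I -> M) : to_loc (\sum_i F i) = \sum_i to_loc (F i).
Proof. exact: (big_morph _ (@to_locD M) erefl). Qed.

Lemma common_denominator n (w : 'I_n -> T) :
  exists (u : nzd R) (b : 'I_n -> R), forall i, to_total (nzd_val u) * w i = to_total (b i).
Proof.
suff [u ub] : exists u : nzd R, forall z, z \in [seq w i | i <- enum 'I_n] ->
    exists b, to_total (nzd_val u) * z = to_total b.
  have wb i : exists b, to_total (nzd_val u) * w i = to_total b.
    by apply: ub; apply/mapP; exists i; rewrite ?mem_enum.
  by have [b bE] := choice wb; exists u, b.
elim: [seq _ | _ <- _] => [|z l [u ul]]; first by exists (nzd1 R).
elim/locW: z => a s; exists (nzd_mul u s) => z; rewrite inE => /orP [/eqP ->|/ul [b bE]].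
  exists (nzd_val u * a); rewrite /= !to_totalM -mulrA.
  by rewrite [to_total _ * Defs.frac a s](@to_total_frac R^o).
by exists (nzd_val s * b); rewrite /= !to_totalM mulrAC bE mulrC.
Qed.

(** Numerators of a basis of U^-1 M are a basis of M up to torsion, since denominators become units.
    Conversely, linear relations over the total ring of fractions are brought back to R by a common
    denominator. *)
Lemma has_rankP M r : has_rank M r <-> rank_of M r.
Proof.
split=> [/lmod_iso_sym /lmod_isoP [g [ginj gsurj]]|[f [finj fspan]]].
  have gfrac i : exists xs : M * nzd R, g (delta_mx 0 i) = Defs.frac xs.1 xs.2.
    by elim/locW: (g _) => x s; exists (x, s).
  have [xs xsE] := choice gfrac.
  have [f fE] := rV_lin_ex (fun i => (xs i).1).
  have key (v : 'rV[R]_r) :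
      to_loc (f v) = g (\row_i (to_total (v 0 i) * to_total (nzd_val (xs i).2))).
    rewrite [RHS]rV_lin_sum fE to_loc_sum; apply: eq_bigr => i _.
    by rewrite mxE xsE -scalerA to_total_frac to_locZ.
  exists f; split.
    apply: linear_inj => v fv0.
    have : g (\row_i (to_total (v 0 i) * to_total (nzd_val (xs i).2))) = g 0.
      by rewrite -key fv0 linear0.
    move=> /ginj /rowP v0; apply/rowP => i; rewrite mxE.
    have := v0 i; rewrite !mxE -to_totalM -[RHS]/(to_total 0).
    move=> /to_loc_eq [u ru]; rewrite scaler0 => /ru vs.
    by apply: (@nzd_regular (xs i).2); rewrite mulrC.
  move=> x; have [w wE] := gsurj (to_loc x).
  have [u [b ub]] := common_denominator (fun i => w 0 i * (Defs.frac (1 : R^o) (xs i).2 : T)).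
  have : to_loc (f (\row_i b i)) = to_loc (nzd_val u *: x).
    rewrite key to_locZ -wE -linearZ; congr (g _); apply/rowP => i; rewrite !mxE -ub.
    by rewrite -!mulrA [_ * to_total _]mulrC to_totalK mulr1.
  move=> /to_loc_eq [u' ru' uE]; exists (u' * nzd_val u); split.
    by apply: regularM => //; apply: nzd_regular.
  by exists (u' *: \row_i b i); rewrite linearZ -scalerA.
apply: lmod_iso_sym; apply/lmod_isoP.
have [g gE] := rV_lin_ex (fun i => to_loc (f (delta_mx 0 i))).
have key (v : 'rV[R]_r) : g (\row_i to_total (v 0 i)) = to_loc (f v).
  rewrite gE [in RHS]rV_lin_sum to_loc_sum; apply: eq_bigr => i _.
  by rewrite mxE to_locZ.
exists g; split.
  apply: linear_inj => w gw; have [u [b ub]] := common_denominator (fun i => w 0 i).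
  have : to_loc (f (\row_i b i)) = to_loc 0.
    rewrite -key; transitivity (to_total (nzd_val u) *: g w); last by rewrite gw scaler0.
    by rewrite -linearZ; congr (g _); apply/rowP => i; rewrite !mxE ub.
  move=> /to_loc_eq [u' ru']; rewrite scaler0 -linearZ -(linear0 f) => /finj /(regular_rV ru').
  move=> /rowP b0; apply/rowP => i; have := ub i; have := b0 i; rewrite !mxE => -> ui.
  by rewrite -[LHS]mul1r -(to_totalK u) mulrAC ui mul0r.
elim/locW => x s; have [u [ru [v uv]]] := fspan x.
have [u' u'E] := regular_nzd ru.
exists ((Defs.frac (1 : R^o) (nzd_mul u' s) : T) *: \row_i to_total (v 0 i)).
transitivity ((Defs.frac (1 : R^o) (nzd_mul u' s) : T) *: to_loc (f v)).
  by rewrite linearZ key.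
rewrite -uv -u'E [LHS]fracZ; apply/fracP; exists (nzd1 R).
by rewrite /= !scale1r mulr1 scalerA [_ * nzd_val s]mulrC.
Qed.

End TotalFractionRank.

(** * Finite projective dimension *)

Section FiniteProjectiveDimension.
Variables (R : comNzRingType) (m : idealr R).
Hypotheses (Rn : noetherian R) (Rl : local_ring m).
Implicit Types M : lmodType R.

Lemma free_res_finite_pdim s M : free_res s M -> finite_pdim M.
Proof.
move=> /(free_res_resolution Rn) [A [Ares An _]]; exists A; split.
  by split=> // n; rewrite An; apply: rV_projective.
exists (size s) => n ns; rewrite An nth_default 1?ltnW // => x.
by apply/rowP; case.
Qed.

(** Modulo m the matrix 1 + E is the identity, so its determinant is a unit and the adjugate cancels
    it. *)
Lemma minus_idempotent_in_max_eq0 a (E : 'M[R]_a) :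
  (forall i j, E i j \in m) -> (1%:M + E) *m E = 0 -> E = 0.
Proof.
move=> Em E0.
have : \det (1%:M + E) \notin m.
  apply/negP => /resfield_class0; rewrite /resfield_class -det_map_mx.
  have -> : map_mx (\pi_{ideal_quot m}%qT) (1%:M + E) = 1%:M.
    rewrite map_mxD map_mx1 -[RHS]addr0; congr (_ + _); apply/matrixP => i j.
    by rewrite !mxE; apply/resfield_class0.
  by rewrite det1 => /eqP; rewrite oner_eq0.
move=> /(local_unit Rn Rl) [b bd].
have : b *: (\adj (1%:M + E) *m ((1%:M + E) *m E)) = E.
  by rewrite mulmxA mul_adj_mx mul_scalar_mx scalerA bd scale1r.
by rewrite E0 mulmx0 scaler0.
Qed.

Lemma minimal_free_cover M : fin_gen M ->
  inhabited (free_cover (@fin_gen R) (@minimal_cover R m) M).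
Proof.
move=> /(minimal_cover_ex Rn Rl) [n [p pmin]]; constructor.
apply: (@FreeCover _ _ _ _ n _ _ p (ses_ker pmin.1)) => //.
apply: (fin_gen_sub Rn (@submod_incl_inj _ _ _)).
exact: fin_gen_rV.
Qed.

(* A minimal free resolution A is homotopy equivalent to the projective one, which
   vanishes above n. The homotopy makes -e = - d h a projection of A_n onto its
   n+1-st syzygy, and the matrix of e has entries in m, so e = 0. *)
Lemma finite_pdim_free_res M : fin_gen M -> finite_pdim M ->
  exists a s, free_res (a :: s) M.
Proof.
move=> Mfg [P [[Pres Pproj] [n Pn]]].
pose cov := minimal_free_cover.
pose A := syz_resolution cov Mfg.
have [Ares Aproj] := syz_resolutionP cov Mfg.
have [f [g [h [_ [fC gC [_ hS] _]]]]] : homotopy_equiv A P.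
  by apply: resolution_homotopy_equiv => j; apply: projective_lifts.
have [iinj _ iker] := syz_ses cov Mfg n.
pose i := syz_i cov Mfg n; pose p := syz_p cov Mfg n.
pose d := syz_diff cov Mfg n.
(* P vanishes in degree n+1, so the homotopy identity there reads -x = d h x + h d x; apply d. *)
have hd x : d (h n (d x)) = - d x.
  have hx : g n.+1 (f n.+1 x) - x = cdiff A n.+1 (h n.+1 x) + h n (d x) := hS n x.
  have dK z : d (cdiff A n.+1 z) = 0 := @cdiffK R A n z.
  have := congr1 d hx; rewrite (Pn n.+1 (leqnn _) (f n.+1 x)) linear0 sub0r.
  by rewrite linearN linearD dK add0r => <-.
pose e : {linear 'rV[R]_(syz_n cov Mfg n) -> 'rV[R]_(syz_n cov Mfg n)} :=
  [the {linear _ -> _} of d \o h n].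
have pe y : p (e y) = 0 by apply: ses_comp (syz_ses cov Mfg n) _.
have ei z : e (i z) = - i z.
  case: (syz_ses cov Mfg n.+1) => _ psurj _; have [x <-] := psurj z.
  exact: hd.
have E0 : lin1_mx e = 0.
  apply: minus_idempotent_in_max_eq0 => [k l|].
    have [_ pm] := syz_good cov Mfg n.
    have -> : lin1_mx e k l = e (delta_mx 0 k) 0 l by rewrite -mul_rV_lin1 -rowE !mxE.
    exact/pm/pe.
  apply/row_matrixP => k; rewrite row0 rowE mulmxA mul_rV_lin1 mulmxDr mulmx1 mul_rV_lin1.
  have /iker [z zE] := pe (delta_mx 0 k).
  by rewrite linearD -zE ei subrr.
have Z0 : zero_module (syz cov Mfg n.+1).
  move=> z; apply: iinj; apply: oppr_inj; rewrite -[LHS]ei -mul_rV_lin1 E0 mulmx0.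
  by rewrite linear0 oppr0.
have [s ss] : exists s, free_res s (syz cov Mfg 1).
  (* From the vanishing syzygy, the covers are prepended one at a time down to the first syzygy. *)
  have : exists s, free_res s (syz cov Mfg n.+1) by exists [::].
  elim: n {P Pres Pproj Pn A Ares Aproj f g h fC gC hS iinj iker i p d hd e pe ei E0 Z0} => //.
  move=> n IHn [s ss]; apply: IHn.
  exists (syz_n cov Mfg n.+1 :: s), (syz cov Mfg n.+2).
  by exists (syz_i cov Mfg n.+1), (syz_p cov Mfg n.+1); split=> //; apply: syz_ses.
exists (syz_n cov Mfg 0), s, (syz cov Mfg 1), (syz_i cov Mfg 0), (syz_p cov Mfg 0).
by split=> //; apply: syz_ses.
Qed.

End FiniteProjectiveDimension.

Theorem theorem2p9 (R : comNzRingType) (m : idealr R) (M : lmodType R)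
  (R_noetherian : noetherian R) (R_local : local_ring m)
  (M_fin_gen : fin_gen M) (M_finite_Gdim : finite_Gdim M) :
  (exists r : nat, has_rank M r /\ G_Euler_char m M = r%:Z) <-> finite_pdim M.
Proof.
split=> [[r [/has_rankP Mr chi]]|Mpd]; last first.
  have [a [s Ms]] := finite_pdim_free_res R_noetherian R_local M_fin_gen Mpd.
  have [r [Mr sr]] := free_res_rank R_noetherian Ms.
  exists r; split; first exact/has_rankP.
  (* The free resolution itself serves as approximation: G = R^a, with the identity as minimal
     cover. *)
  rewrite -sr; have [K [i [p [e Ks]]]] := Ms.
  apply: (G_Euler_charE R_noetherian R_local e Ks).
    apply: (totally_reflexive_free R_noetherian (n := a)).
    by exists [the {linear _ -> _} of idfun]; exists id.
  exact: (tensor_dim R_noetherian R_local (minimal_cover_id m a)).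
have [K [G [i [p [s [e Gt Ks]]]]]] := approximation R_noetherian M_finite_Gdim.
have [Gfg _ _ _] := Gt.
have [nu [q qmin]] := minimal_cover_ex R_noetherian R_local Gfg.
have := G_Euler_charE R_noetherian R_local e Ks Gt (tensor_dim R_noetherian R_local qmin).
have [k [Kk sk]] := free_res_rank R_noetherian Ks.
(* The two values of chi^G give r = nu - k, so nu is the sum of the ranks of M and K. *)
rewrite chi /= sk => /eqP; rewrite eq_sym subr_eq -PoszD => /eqP [nuE].
have Gr : rank_of G nu by rewrite nuE addnC; apply: rank_of_ses e Kk Mr.
have qinj := surj_rank_inj R_noetherian qmin.1 Gr.
have [iinj psurj ker] := e.
(* As [q] is bijective, K embeds into R^nu instead of G, and nu becomes the first term of a free
   resolution of M. *)
have [|c x y x' y' xy x'y'|y|j jE] := @lin_of_rel R K 'rV[R]_nu (fun x y => q y = i x).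
- by move=> x; apply: qmin.1.
- by rewrite !linearP xy x'y'.
- by rewrite linear0 => qy; apply: qinj; rewrite qy linear0.
apply: (@free_res_finite_pdim R R_noetherian (nu :: s)).
exists K, j, [the {linear 'rV[R]_nu -> M} of p \o q]; split=> //; split.
- by move=> x y jxy; apply: iinj; rewrite -!jE jxy.
- by move=> y; have [x <-] := psurj y; have [z <-] := qmin.1 x; exists z.
- move=> x; split=> [/ker [y yE]|[y <-]]; last by rewrite /= jE (ses_comp e).
  by exists y; apply: qinj; rewrite jE.
Qed.
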